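(* Let $\mathcal{H}$ be a separable complex Hilbert space and let $(\Omega,\Sigma,M)$ be a framed POVM on $\mathcal{H}$. Suppose that $\mathcal{M}$ is a dense linear subspace of $\mathcal{H}$ such that for each $x\in\mathcal{M}$ the total variation of the vector measure $E\in\Sigma\mapsto M(E)x\in\mathcal{H}$ is sigma-finite. Then $M$ arises from an operator-valued frame with domain $\mathcal{M}$: there is an operator-valued frame $(\mu,\mathcal{M},\{T(t)\}_{t\in\Omega})$ that gives rise to $M$. Further, if $(\mu_1,\mathcal{M},\{T_1(t)\}_{t\in\Omega})$ and $(\mu_2,\mathcal{M},\{T_2(t)\}_{t\in\Omega})$ are any two operator-valued frames giving rise to $M$, then they are essentially the same in the sense that $$T_1(t)^*T_1(t)\,\frac{d\mu_1}{d(\mu_1+\mu_2)}(t)=T_2(t)^*T_2(t)\,\frac{d\mu_2}{d(\mu_1+\mu_2)}(t)$$ for $(\mu_1+\mu_2)$-a.e. $t$.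
   Context: The inner product of $\mathcal{H}$ is conjugate-linear in its second variable. $\mathcal{L}^+(\mathcal{H})$ denotes the positive semi-definite bounded operators on $\mathcal{H}$. A positive operator-valued measure (POVM) is a triple $(\Omega,\Sigma,M)$ where $(\Omega,\Sigma)$ is a measurable space and $M:\Sigma\to\mathcal{L}^+(\mathcal{H})$ satisfies $M(\varnothing)=0$ and, for pairwise disjoint $E_1,E_2,\dots\in\Sigma$ and $x,y\in\mathcal{H}$, $\langle M(\bigcup_{i=1}^\infty E_i)x,y\rangle=\sum_{i=1}^\infty\langle M(E_i)x,y\rangle$. It is a framed POVM if in addition $M(\Omega)$ is invertible. The total variation of $E\mapsto M(E)x$ is $E\mapsto\sup\sum_i\|M(E_i)x\|$ over finite partitions of $E$ into members of $\Sigma$. A $\Sigma$-measurable family of Hilbert spaces $\{\mathcal{K}(t)\}_{t\in\Omega}$ is a family of (separable) Hilbert spaces together with a linear subspace $\mathcal{S}\subset\prod_{t}\mathcal{K}(t)$ of ''measurable vector fields'' such that: $t\mapsto\|u(t)\|$ is measurable for each $u\in\mathcal{S}$; any $v\in\prod_t\mathcal{K}(t)$ for which $t\mapsto\langle v(t),u(t)\rangle$ is measurable for all $u\in\mathcal{S}$ belongs to $\mathcal{S}$; and there is a sequence in $\mathcal{S}$ whose values at $t$ span a dense subspace of $\mathcal{K}(t)$ for every $t$. For a measure $\mu$ on $(\Omega,\Sigma)$, the direct integral $\int_\Omega^\oplus\mathcal{K}(t)\,d\mu(t)$ is the Hilbert space of ($\mu$-a.e. classes of) measurable vector fields $u$ with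 $\int_\Omega\|u(t)\|^2\,d\mu(t)<\infty$. Operator-valued frame (OVF): let $(\Omega,\Sigma,\mu)$ be a measure space, $\mathcal{M}$ a dense linear subspace of $\mathcal{H}$, $\{\mathcal{K}(t)\}_{t\in\Omega}$ a $\Sigma$-measurable family of Hilbert spaces, and $T(t):\mathcal{M}\to\mathcal{K}(t)$, $t\in\Omega$, linear maps such that for every $x\in\mathcal{M}$ one has $\{T(t)x\}_{t\in\Omega}\in\int_\Omega^\oplus\mathcal{K}(t)\,d\mu(t)$, and the map $x\in\mathcal{M}\mapsto\{T(t)x\}_{t\in\Omega}$ is bounded above and below, i.e. there are $A,B>0$ with $A\|x\|^2\le\int_\Omega\langle T(t)^*T(t)x,x\rangle\,d\mu(t)\le B\|x\|^2$ for every $x\in\mathcal{M}$. Then $(\mu,\mathcal{M},\{T(t)\}_{t\in\Omega})$ is called an operator-valued frame. Here $\langle T(t)^*T(t)x,y\rangle$ is understood as $\langle T(t)x,T(t)y\rangle_{\mathcal{K}(t)}$ for $x,y\in\mathcal{M}$. The OVF $(\mu,\mathcal{M},\{T(t)\}_{t\in\Omega})$ gives rise to the POVM $M$ (equivalently, $M$ arises from it) if $\langle M(E)x,y\rangle=\int_E\langle T(t)^*T(t)x,y\rangle\,d\mu(t)$ for all $x,y\in\mathcal{M}$ and all $E\in\Sigma$. $\frac{d\mu_i}{d(\mu_1+\mu_2)}$ denotes the Radon-Nikodym derivative of $\mu_i$ with respect to $\mu_1+\mu_2$.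
   Formalization: The uniqueness identity is proved as equality of the forms ⟨T_i(t)x,T_i(t)y⟩ times the derivatives for each fixed x,y in 𝓜, for a.e. t (null set may depend on x,y), for any given versions of the derivatives; one common null set is false for arbitrary linear T_i(t). *)

(* Defs.v *)
From HB Require Import structures.
From mathcomp Require Import all_boot all_order all_algebra.
From mathcomp Require Import all_classical all_reals all_analysis.
From mathcomp Require Import complex.

Set Implicit Arguments.
Unset Strict Implicit.
Unset Printing Implicit Defensive.

Import Order.TTheory GRing.Theory Num.Theory.
Import numFieldNormedType.Exports.

Local Open Scope classical_set_scope.
Local Open Scope complex_scope.
Local Open Scope ring_scope.

(* Complex Hilbert spaces. In a form of type {dot H for conj} the first
   variable is linear and the second conjugate-linear. *)
HB.mixin Record CompleteNormedModule_isHilbert (R : realType) H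
    of CompleteNormedModule R[i] H := {
  inner : {dot H for Num.conj : R[i] -> R[i]} ;
  sqr_norm_inner : forall x : H, `|x| ^+ 2 = inner x x
}.

#[short(type="hilbertType")]
HB.structure Definition Hilbert (R : realType) :=
  {H of CompleteNormedModule R[i] H & CompleteNormedModule_isHilbert R H}.

Arguments inner {R s}.

(* The norm of a normed module over R[i] takes values in R[i]; [rnorm] is the
   same number, in R. *)
Definition rnorm (R : realType) (V : normedModType R[i]) (x : V) : R :=
  complex.Re `|x|.

Definition separable_space (T : topologicalType) : Prop :=
  exists2 S : set T, countable S & dense S.

Definition dense_subspace (R : realType) (H : hilbertType R) (D : set H) :=
  [/\ D 0, (forall (a : R[i]) (x y : H), D x -> D y -> D (a *: x + y))
    & dense D].

Section complex_functions.
Context d (Omega : measurableType d) (R : realType).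

Definition cmeasurable (f : Omega -> R[i]) : Prop :=
  measurable_fun setT (fun t => complex.Re (f t)) /\
  measurable_fun setT (fun t => complex.Im (f t)).

Definition cintegral (mu : {measure set Omega -> \bar R}) (E : set Omega)
    (f : Omega -> R[i]) : R[i] :=
  Rintegral mu E (fun t => complex.Re (f t)) +i*
  Rintegral mu E (fun t => complex.Im (f t)).

(* [g] is a version of the Radon-Nikodym derivative of [nu] with respect to
   [mu]. The library's 'd nu '/d mu only covers finite [nu]. *)
Definition is_RN_derivative (nu mu : {measure set Omega -> \bar R})
    (g : Omega -> R) : Prop :=
  [/\ measurable_fun setT g, (forall t, 0 <= g t)
    & forall E, measurable E -> nu E = (\int[mu]_(t in E) (g t)%:E)%E].

End complex_functions.

Section povm.
Context d (Omega : measurableType d) (R : realType) (H : hilbertType R).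

Definition bounded_operator (f : H -> H) : Prop :=
  exists C : R, forall x, rnorm (f x) <= C * rnorm x.

(* For z in R[i], 0 <= z means that z is real and nonnegative. *)
Definition positive_operator (f : H -> H) : Prop :=
  forall x, 0 <= inner (f x) x.

(* The values of a POVM outside the sigma-algebra are irrelevant. *)
Definition is_povm (M : set Omega -> {linear H -> H}) : Prop :=
  [/\ forall E, measurable E ->
        bounded_operator (M E) /\ positive_operator (M E),
      forall x, M set0 x = 0
    & forall (E : nat -> set Omega) (x y : H),
        (forall i, measurable (E i)) -> trivIset setT E ->
        (fun n => \sum_(0 <= i < n) inner (M (E i) x) y : R[i]^o) @ \oo -->
        (inner (M (\bigcup_i E i) x) y : R[i]^o)].

Definition invertible_operator (f : H -> H) : Prop :=
  exists g : {linear H -> H}, [/\ bounded_operator g, cancel f g & cancel g f].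

Definition is_framed_povm (M : set Omega -> {linear H -> H}) : Prop :=
  is_povm M /\ invertible_operator (M setT).

(* Empty pieces are allowed in the partition; they contribute 0 to the sum. *)
Definition vmeasure_total_variation (m : set Omega -> H) (E : set Omega) : \bar R :=
  ereal_sup [set s | exists n (P : 'I_n -> set Omega),
    [/\ forall i, measurable (P i), trivIset setT P, \bigcup_i P i = E
      & s = (\sum_(i < n) rnorm (m (P i)))%:E]].

End povm.

Section ovf.
Context d (Omega : measurableType d) (R : realType).

Definition is_measurable_family (K : Omega -> hilbertType R)
    (S : set (forall t, K t)) : Prop :=
  [/\ S (fun=> 0) /\
        (forall (a : R[i]) u v, S u -> S v -> S (fun t => a *: u t + v t)),
      forall u, S u -> measurable_fun setT (fun t => rnorm (u t)),
      forall v : (forall t, K t),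
        (forall u, S u -> cmeasurable (fun t => inner (v t) (u t))) -> S v
    & exists e : nat -> forall t, K t, (forall n, S (e n)) /\
        forall t, dense [set v : K t | exists n (c : 'I_n -> R[i]),
          v = \sum_(i < n) c i *: e i t]].

(* [u] represents an element of the direct integral. *)
Definition in_direct_integral (mu : {measure set Omega -> \bar R})
    (K : Omega -> hilbertType R) (S : set (forall t, K t))
    (u : forall t, K t) : Prop :=
  S u /\ (\int[mu]_t (rnorm (u t) ^+ 2)%:E < +oo)%E.

Context (H : hilbertType R).

(* Operator-valued frames with domain [D]. The linear maps T(t) : D -> K(t)
   are represented by functions on [H] whose values outside [D] are
   irrelevant. *)
Record OVF (D : set H) := {
  ovf_measure : {measure set Omega -> \bar R} ;
  ovf_space : Omega -> hilbertType R ;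
  ovf_field : set (forall t, ovf_space t) ;
  ovf_map : forall t, H -> ovf_space t ;
  _ : dense_subspace D ;
  _ : is_measurable_family ovf_field ;
  _ : forall t (a : R[i]) x y, D x -> D y ->
        ovf_map t (a *: x + y) = a *: ovf_map t x + ovf_map t y ;
  _ : forall x, D x ->
        in_direct_integral ovf_measure ovf_field (fun t => ovf_map t x) ;
  _ : exists A B : R, [/\ 0 < A, 0 < B & forall x, D x ->
        ((A * rnorm x ^+ 2)%:E
           <= \int[ovf_measure]_t
                (complex.Re (inner (ovf_map t x) (ovf_map t x)))%:E
           <= (B * rnorm x ^+ 2)%:E)%E]
}.

(* <T(t)^* T(t) x, y>, that is <T(t) x, T(t) y>; T(t) may be unbounded. An
   almost everywhere identity between such forms is meant for each x and y:
   as D may have uncountable dimension and T(t) is an arbitrary linear map,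
   there is in general no null set that works for all x and y at once. *)
Definition ovf_form (D : set H) (F : OVF D) (t : Omega) (x y : H) : R[i] :=
  inner (ovf_map F t x) (ovf_map F t y).

Definition gives_rise_to (D : set H) (F : OVF D)
    (M : set Omega -> {linear H -> H}) : Prop :=
  forall x y E, D x -> D y -> measurable E ->
    inner (M E x) y = cintegral (ovf_measure F) E (fun t => ovf_form F t x y).

End ovf.

(* Main.v *)
Require Import Defs.
From HB Require Import structures.
From mathcomp Require Import all_boot all_order all_algebra.
From mathcomp Require Import all_classical all_reals all_analysis.
From mathcomp Require Import measurable_realfun simple_functions.
From mathcomp Require Import complex ring lra.

Set Implicit Arguments.
Unset Strict Implicit.
Unset Printing Implicit Defensive.

Import Order.TTheory GRing.Theory Num.Theory.
Import numFieldNormedType.Exports.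

Local Open Scope classical_set_scope.
Local Open Scope complex_scope.
Local Open Scope ring_scope.

Local Notation Re := complex.Re.
Local Notation Im := complex.Im.
Local Arguments conjc : simpl never.

(**
Existence. All fibres are H itself, and the Cholesky decomposition replaces any
operator square root. Let e be a sequence of vectors of H that are orthonormal
or null and span a dense subspace (Gram-Schmidt). The complex measures
<M(E) e_i, e_j> have densities h i j with respect to one finite measure mu
([povm_kernel]). Positivity of M makes the matrix (h i j t) positive
semi-definite for almost every t; on the remaining null set h can be
replaced by 0. The Cholesky factor L of such a matrix is measurable in t and
lower triangular, with L L^* = h ([choleskyE]), so the fields v_i(t), the sum
over k of L_ik(t) e_k, have values in H and Gram matrix h(t)
([inner_kernel_field]).

Let V send a finite combination of the e_i to the same combination of the v_i.
Then the integral over E of |V p|^2 is <M(E) p, p> ([povm_fields]). As M(Omega)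
is bounded, V extends to all x in H as a limit in the space of square integrable
fields ([l2_complete]); the extension keeps the identity
([extension_rel_quad]). It is defined only up to null sets depending on x,
whereas T(t) must be linear in x for every t: the pairs (x, u) such that u is a
version of V x form a linear relation, which contains the graph of a linear map
([linear_selection]). Evaluation of this map at t is T(t). Polarization gives
the identity for <M(E) x, y>, and positivity and invertibility of M(Omega) give
the frame bounds ([form_bounded], [form_coercive]).

Uniqueness. If g is a density of the measure of a frame giving rise to M, then
|T(t) x|^2 g(t) has over every E the integral <M(E) x, x>
([ovf_quad_density]). So for two such frames these functions agree almost
everywhere, and the forms agree by polarization ([ovf_form_unique]).
*)

(** * Complex numbers and inner products *)

Section complex_numbers.
Context (R : realType).
Implicit Types z w : R[i].

Lemma complexP z w : Re z = Re w -> Im z = Im w -> z = w.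
Proof. by case: z w => a b [c e] /= -> ->. Qed.

Lemma ReD z w : Re (z + w) = Re z + Re w. Proof. by case: z w => ? ? []. Qed.
Lemma ImD z w : Im (z + w) = Im z + Im w. Proof. by case: z w => ? ? []. Qed.
Lemma ReN z : Re (- z) = - Re z. Proof. by case: z. Qed.
Lemma ImN z : Im (- z) = - Im z. Proof. by case: z. Qed.
Lemma ReB z w : Re (z - w) = Re z - Re w. Proof. by rewrite ReD ReN. Qed.
Lemma ReM z w : Re (z * w) = Re z * Re w - Im z * Im w.
Proof. by case: z w => ? ? []. Qed.
Lemma ImM z w : Im (z * w) = Re z * Im w + Im z * Re w.
Proof. by case: z w => ? ? []. Qed.
Lemma ReJ z : Re z^*%C = Re z. Proof. by case: z. Qed.
Lemma ImJ z : Im z^*%C = - Im z. Proof. by case: z. Qed.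

Lemma Re_sum I (s : seq I) (F : I -> R[i]) :
  Re (\sum_(i <- s) F i) = \sum_(i <- s) Re (F i).
Proof. by by elim/big_rec2: _ => // i y1 y2 _ <-; rewrite ReD. Qed.

Lemma ge0_complexE z : (0 <= z) = (Im z == 0) && (0 <= Re z).
Proof. by rewrite lecE. Qed.

Lemma ge0_complex z : 0 <= z -> z = (Re z)%:C.
Proof. by rewrite ge0_complexE; case: z => a b /= /andP[/eqP -> _]. Qed.

Lemma Re_norm z : Re `|z| = Num.sqrt (Re z ^+ 2 + Im z ^+ 2).
Proof. by rewrite normc_def. Qed.

Lemma norm_Re z : `|Re z| <= Re `|z|.
Proof.
rewrite Re_norm -sqrtr_sqr; apply: ler_wsqrtr.
by rewrite lerDl sqr_ge0.
Qed.

End complex_numbers.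

Section inner_product.
Context (R : realType) (H : hilbertType R).
Implicit Types (x y z : H) (a : R[i]).

Lemma innerDl x y z : inner (x + y) z = inner x z + inner y z.
Proof. exact: linearDl. Qed.

Lemma innerDr x y z : inner x (y + z) = inner x y + inner x z.
Proof. exact: linearDr. Qed.

Lemma innerZl a x y : inner (a *: x) y = a * inner x y.
Proof. exact: linearZl_LR. Qed.

Lemma innerZr a x y : inner x (a *: y) = a^*%C * inner x y.
Proof. exact: linearZr_LR. Qed.

Lemma innerC x y : inner y x = (inner x y)^*%C.
Proof. by rewrite hermC expr0 mul1r. Qed.

Lemma inner0l x : inner 0 x = 0. Proof. exact: linear0l. Qed.
Lemma inner0r x : inner x 0 = 0. Proof. exact: linear0r. Qed.
Lemma innerNl x y : inner (- x) y = - inner x y. Proof. exact: linearNl. Qed.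
Lemma innerNr x y : inner x (- y) = - inner x y. Proof. exact: linearNr. Qed.
Lemma innerBl x y z : inner (x - y) z = inner x z - inner y z.
Proof. exact: linearBl. Qed.
Lemma inner_suml I (s : seq I) (F : I -> H) y :
  inner (\sum_(i <- s) F i) y = \sum_(i <- s) inner (F i) y.
Proof. exact: linear_sumlz. Qed.

Lemma inner_sumr I (s : seq I) (F : I -> H) y :
  inner y (\sum_(i <- s) F i) = \sum_(i <- s) inner y (F i).
Proof. exact: linear_sumr. Qed.

Lemma rnorm_complex x : `|x| = (rnorm x)%:C.
Proof. by rewrite [LHS]ge0_complex. Qed.

Lemma rnorm_ge0 x : 0 <= rnorm x.
Proof. by have := normr_ge0 x; rewrite ge0_complexE => /andP[]. Qed.

Lemma inner_sqr x : inner x x = (rnorm x ^+ 2)%:C.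
Proof. by rewrite -sqr_norm_inner rnorm_complex -rmorphXn. Qed.

Lemma rnorm_sqr x : rnorm x ^+ 2 = Re (inner x x).
Proof. by rewrite inner_sqr. Qed.

Lemma rnorm0 : rnorm (0 : H) = 0.
Proof. by rewrite /rnorm normr0. Qed.

Lemma rnorm_eq0 x : (rnorm x == 0) = (x == 0).
Proof. by rewrite -[x == 0]normr_eq0 rnorm_complex -(inj_eq (@complexI R)). Qed.

Lemma rnormD x y : rnorm (x + y) <= rnorm x + rnorm y.
Proof. by have := ler_normD x y; rewrite !rnorm_complex -rmorphD /= lecR. Qed.

Lemma rnormN x : rnorm (- x) = rnorm x.
Proof. by rewrite /rnorm normrN. Qed.

Lemma rnormZ a x : rnorm (a *: x) = Re `|a| * rnorm x.
Proof.
by rewrite /rnorm normrZ ReM (ger0_Im (normr_ge0 a)) mul0r subr0.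
Qed.

Lemma parallelogram x y :
  rnorm (x + y) ^+ 2 + rnorm (x - y) ^+ 2 =
  2 * rnorm x ^+ 2 + 2 * rnorm y ^+ 2.
Proof.
rewrite !rnorm_sqr !innerDl !innerDr !innerNl !innerNr opprK !ReD !ReN.
ring.
Qed.

Lemma Re_inner_polar x y :
  Re (inner x y) = (rnorm (x + y) ^+ 2 - rnorm (x - y) ^+ 2) / 4.
Proof.
rewrite !rnorm_sqr !innerDl !innerDr !innerNl !innerNr opprK !ReD !ReN.
by rewrite (innerC x y) ReJ; field.
Qed.

Lemma Re_innerZi x y : Re (inner x ('i%C *: y)) = Im (inner x y).
Proof. by rewrite innerZr ReM /=; ring. Qed.

Lemma Im_inner_polar x y :
  Im (inner x y) =
  (rnorm (x + 'i%C *: y) ^+ 2 - rnorm (x - 'i%C *: y) ^+ 2) / 4.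
Proof. by rewrite -Re_innerZi Re_inner_polar. Qed.

End inner_product.

(** * Gram-Schmidt orthonormalization *)

Section approximation.
Context (R : realType) (H : hilbertType R).
Implicit Types (x y z : H).

(** The norm of H takes its values in R[i], so the balls of H have complex
    radii; this restates density with real radii. *)
Lemma dense_rnormP (S : set H) :
  dense S <-> forall x (e : R), 0 < e -> exists2 y, S y & rnorm (x - y) < e.
Proof.
split=> [dS x e e0|hS O [x Ox] oO].
  have e0' : 0 < e%:C :> R[i] by rewrite ltcR.
  have [||y [xy Sy]] := dS (ball x e%:C)°.
  - by exists x; exact: nbhsx_ballx.
  - exact: open_interior.
  - exists y => //; have := interior_subset xy.
    by rewrite -ball_normE /= rnorm_complex ltcR.
have /nbhs_ballP[e /= e0 xeO] : nbhs x O by apply: open_nbhs_nbhs.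
have ee : e = (Re e)%:C by apply: ge0_complex; exact: ltW.
have [|y Sy xy] := hS x (Re e); first by rewrite ee ltcR in e0.
exists y; split=> //; apply: xeO; rewrite -ball_normE /=.
by rewrite ee rnorm_complex ltcR.
Qed.

Lemma separable_dense_seq : separable_space H ->
  exists z : nat -> H, forall x (e : R), 0 < e ->
    exists n, rnorm (x - z n) < e.
Proof.
move=> [S cS dS].
have [y0 Sy0 _] := (dense_rnormP S).1 dS 0 1 ltr01.
have /pfcard_geP[S0|[f]] := cS; first by move: Sy0; rewrite S0.
exists f => x e e0; have [y Sy xy] := (dense_rnormP S).1 dS x e e0.
by have [n _ fn] := @surj _ _ _ _ f y Sy; exists n; rewrite fn.
Qed.

End approximation.

Section gram_schmidt.
Context (R : realType) (H : hilbertType R).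
Implicit Types (x y : H).

(** The null vector stays null, so that Gram-Schmidt below can meet linearly
    dependent vectors. *)
Definition normalize x : H := ((rnorm x)^-1)%:C *: x.

Lemma normalizeK x : (rnorm x)%:C *: normalize x = x.
Proof.
have [->|x0] := eqVneq x 0; first by rewrite /normalize !scaler0.
rewrite scalerA -rmorphM mulfV ?scale1r//.
by rewrite rnorm_eq0.
Qed.

Lemma inner_normalize_sqr x : inner (normalize x) (normalize x) = (x != 0)%:R.
Proof.
rewrite innerZl innerZr inner_sqr conjc_real -!rmorphM /=.
have [->|x0] := eqVneq x 0; first by rewrite rnorm0 expr2 !mulr0.
suff -> : (rnorm x)^-1 * ((rnorm x)^-1 * rnorm x ^+ 2) = 1 by [].
by field; rewrite rnorm_eq0.
Qed.

Variable z : nat -> H.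

(** The component of x orthogonal to the first n Gram-Schmidt vectors. The
    recursion removes from x its projection on the n-th of them, itself the
    normalized residual of the n-th vector of the sequence. *)
Fixpoint gs_residual n x : H :=
  if n is m.+1 then
    let w := normalize (gs_residual m (z m)) in
    gs_residual m x - inner (gs_residual m x) w *: w
  else x.

Definition gram_schmidt n := normalize (gs_residual n (z n)).

Lemma gs_residual_orthogonal n x k : (k < n)%N ->
  inner (gs_residual n x) (gram_schmidt k) = 0.
Proof.
elim: n x k => // n IHn x k; rewrite ltnS leq_eqVlt => /predU1P[->|kn] /=.
  rewrite innerBl innerZl inner_normalize_sqr.
  have [r0|_] := eqVneq (gs_residual n (z n)) 0; last by rewrite mulr1 subrr.
  by rewrite /gram_schmidt /normalize r0 scaler0 inner0r mul0r subr0.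
rewrite innerBl IHn// sub0r innerZl.
have -> : inner (normalize (gs_residual n (z n))) (gram_schmidt k) = 0.
  by rewrite innerZl IHn// mulr0.
by rewrite mulr0 oppr0.
Qed.

Lemma gram_schmidt_orthogonal i j : i != j ->
  inner (gram_schmidt i) (gram_schmidt j) = 0.
Proof.
rewrite neq_ltn => /orP[ij|ji]; last first.
  by rewrite innerZl gs_residual_orthogonal// mulr0.
by rewrite innerC [X in X^*%C]innerZl gs_residual_orthogonal// mulr0 conjc0.
Qed.

Lemma gram_schmidt_sqr i :
  inner (gram_schmidt i) (gram_schmidt i) = (gram_schmidt i != 0)%:R.
Proof.
rewrite inner_normalize_sqr; congr (_ : bool)%:R; congr (~~ _).
apply/idP/idP => [/eqP r0|/eqP e0].
  by rewrite /gram_schmidt r0 /normalize scaler0.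
by rewrite -[X in X == _]normalizeK -/(gram_schmidt i) e0 scaler0.
Qed.

Lemma gs_residual_span n x : exists c : nat -> R[i],
  x = gs_residual n x + \sum_(i < n) c i *: gram_schmidt i.
Proof.
elim: n => [|n [c xE]]; first by exists (fun=> 0); rewrite big_ord0 addr0.
exists (fun i => if i == n then inner (gs_residual n x) (gram_schmidt n)
                 else c i).
rewrite big_ord_recr /= eqxx -/(gram_schmidt n).
under eq_bigr => i _ do rewrite ltn_eqF//.
by rewrite [X in _ = _ + X]addrC addrA subrK.
Qed.

Lemma gram_schmidt_span n : exists c : nat -> R[i],
  z n = \sum_(i < n.+1) c i *: gram_schmidt i.
Proof.
have [c zE] := gs_residual_span n (z n).
exists (fun i => if i == n then (rnorm (gs_residual n (z n)))%:C else c i).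
rewrite big_ord_recr /= eqxx normalizeK {1}zE addrC; congr (_ + _).
by apply: eq_bigr => i _; rewrite ltn_eqF.
Qed.

End gram_schmidt.

(** * Cholesky decomposition of positive semi-definite kernels *)

Section psd_kernels.
Context (R : realType).
Implicit Types (h g : nat -> nat -> R[i]) (s t : seq (R[i] * nat)).

(** The value at a pair of formal linear combinations of the sesquilinear form
    with matrix h; a pair (c, i) stands for c times the i-th basis vector. *)
Definition kernel_form h s t : R[i] :=
  \sum_(a <- s) \sum_(b <- t) a.1 * b.1^*%C * h a.2 b.2.

Definition psd_kernel h := forall s, 0 <= kernel_form h s s.

Lemma kernel_form_cons h a s :
  kernel_form h (a :: s) (a :: s) =
  a.1 * a.1^*%C * h a.2 a.2 + a.1 * (\sum_(b <- s) b.1^*%C * h a.2 b.2) +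
  a.1^*%C * (\sum_(b <- s) b.1 * h b.2 a.2) + kernel_form h s s.
Proof.
rewrite /kernel_form big_cons big_cons -!addrA; congr (_ + _).
rewrite mulr_sumr; congr (_ + _); first by apply: eq_bigr => b _; ring.
rewrite mulr_sumr -big_split /=; apply: eq_bigr => b _.
by rewrite big_cons; congr (_ + _); ring.
Qed.

Lemma kernel_form1 h a : kernel_form h [:: a] [:: a] = a.1 * a.1^*%C * h a.2 a.2.
Proof. by rewrite /kernel_form !big_seq1. Qed.

Lemma kernel_form2 h a b :
  kernel_form h [:: a; b] [:: a; b] =
  a.1 * a.1^*%C * h a.2 a.2 + a.1 * b.1^*%C * h a.2 b.2 +
  a.1^*%C * b.1 * h b.2 a.2 + b.1 * b.1^*%C * h b.2 b.2.
Proof. by rewrite kernel_form_cons kernel_form1 !big_seq1 !mulrA. Qed.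

Lemma psd_diag_ge0 h i : psd_kernel h -> 0 <= h i i.
Proof.
by move=> /(_ [:: (1, i)]); rewrite kernel_form1 /=; rewrite conjc1 !mul1r.
Qed.

(** The form is real at e_i + e_j and at e_i + i e_j. *)
Lemma psd_hermitian h i j : psd_kernel h -> h j i = (h i j)^*%C.
Proof.
move=> hP; have := hP [:: (1, i); (1, j)]; have := hP [:: (1, i); ('i%C, j)].
rewrite !kernel_form2 /= !conjc1 !mul1r.
have := psd_diag_ge0 i hP; have := psd_diag_ge0 j hP.
rewrite !ge0_complexE => /andP[/eqP ij _] /andP[/eqP ii _].
move=> /andP[/eqP h1 _] /andP[/eqP h2 _]; move: h1 h2.
rewrite !(ImD, ImM, ReM, ReD, ReJ, ImJ) /= ii ij.
move=> h1 h2; apply: complexP; rewrite ?ReJ ?ImJ; lra.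
Qed.

(** If h i i = 0, the form at - m (h i j)^* e_i + e_j is an affine function of
    m with slope - 2 |h i j|^2, and it is nonnegative for all m. *)
Lemma psd_null_row h i j : psd_kernel h -> h i i = 0 -> h i j = 0.
Proof.
move=> hP ii.
pose r := Re (h i j) ^+ 2 + Im (h i j) ^+ 2.
have r0 : 0 <= r by rewrite addr_ge0 ?sqr_ge0.
have rP m : 0 <= Re (h j j) - 2 * m * r.
  have := hP [:: ((- m)%:C * (h i j)^*%C, i); (1, j)].
  rewrite kernel_form2 /= ii (psd_hermitian i j hP) ge0_complexE => /andP[_].
  rewrite !(ReD, ReM, ImM, ReJ, ImJ) /= /r => hh.
  apply: le_trans hh _; rewrite le_eqVlt; apply/orP; left; apply/eqP; ring.
have {r0 rP} r0 : r = 0.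
  have [//|r1] := eqVneq r 0.
  have rgt : 0 < r by rewrite lt_def r1.
  have := rP ((Re (h j j) + 1) / (2 * r)).
  have -> : 2 * ((Re (h j j) + 1) / (2 * r)) * r = Re (h j j) + 1.
    by field; rewrite r1.
  by lra.
apply: complexP => /=; apply/eqP; rewrite -sqrf_eq0; apply/eqP;
  have := sqr_ge0 (Re (h i j)); have := sqr_ge0 (Im (h i j)); rewrite /r in r0;
  lra.
Qed.

(** The Schur complement of the pivot p. If h p p = 0 the quotient is 0, and
    nothing is subtracted; this is right, as row p of a positive semi-definite
    kernel then vanishes. *)
Definition schur h p i j : R[i] := h i j - h i p * h p j / h p p.

(** The Schur complement is the form h minimized over the coefficient of e_p:
    its value at s is that of h at s corrected by a multiple of e_p. *)
Lemma schur_form h p s : psd_kernel h ->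
  kernel_form (schur h p) s s =
  kernel_form h ((- (\sum_(b <- s) b.1 * h b.2 p) / h p p, p) :: s)
                ((- (\sum_(b <- s) b.1 * h b.2 p) / h p p, p) :: s).
Proof.
move=> hP; rewrite kernel_form_cons /=; set A := \sum_(b <- s) _.
have AE : \sum_(b <- s) b.1^*%C * h p b.2 = A^*%C.
  rewrite /A rmorph_sum; apply: eq_bigr => b _.
  by rewrite rmorphM /= -(psd_hermitian b.2 p hP).
have hpp : (h p p)^*%C = h p p by rewrite -psd_hermitian.
rewrite AE rmorphM /= rmorphN /= fmorphV /= hpp.
have -> : kernel_form (schur h p) s s = kernel_form h s s - A * A^*%C / h p p.
  rewrite -AE /A mulr_suml mulr_suml -sumrB; apply: eq_bigr => a _.
  rewrite mulr_sumr mulr_suml -sumrB; apply: eq_bigr => b _.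
  by rewrite /schur; ring.
have [->|p0] := eqVneq (h p p) 0.
  by rewrite invr0 !mulr0 !mul0r !addr0 add0r subr0.
by field.
Qed.

Lemma schur_psd h p : psd_kernel h -> psd_kernel (schur h p).
Proof. by move=> hP s; rewrite schur_form. Qed.

Fixpoint schur_iter h n : nat -> nat -> R[i] :=
  if n is m.+1 then schur (schur_iter h m) m else h.

Lemma schur_iter_psd h n : psd_kernel h -> psd_kernel (schur_iter h n).
Proof. by move=> hP; elim: n => //= n; exact: schur_psd. Qed.

Lemma schur_diag_le h p i : psd_kernel h -> schur h p i i <= h i i.
Proof.
move=> hP; rewrite /schur (psd_hermitian i p hP) lerBlDr lerDl.
by rewrite mulr_ge0 ?mulcJ_ge0 ?invr_ge0 ?psd_diag_ge0.
Qed.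

(** The pivot step makes the diagonal entry n vanish, later steps only decrease
    the diagonal, and a null diagonal entry forces a null row. *)
Lemma schur_iter_null_row h n i j : psd_kernel h ->
  (i < n)%N || (h i i == 0) -> schur_iter h n i j = 0.
Proof.
move=> hP ii; apply: psd_null_row; first exact: schur_iter_psd.
elim: n ii => [/eqP//|n IHn]; rewrite ltnS leq_eqVlt -orbA /= => /orP[/eqP ->|].
  rewrite /schur; have [->|p0] := eqVneq (schur_iter h n n n) 0.
    by rewrite mul0r mul0r subr0.
  by rewrite mulfK// subrr.
move=> /IHn g0; apply/eqP; rewrite eq_le.
rewrite psd_diag_ge0 ?andbT; last exact/schur_psd/schur_iter_psd.
by rewrite -g0 schur_diag_le//; exact: schur_iter_psd.
Qed.

(** Column k of the Cholesky factor is column k of the k-th Schur complement,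
    divided by the square root of the pivot. *)
Definition cholesky h i k : R[i] :=
  schur_iter h k i k * ((Num.sqrt (Re (schur_iter h k k k)))^-1)%:C.

Lemma cholesky_lower h i k : psd_kernel h -> (i < k)%N -> cholesky h i k = 0.
Proof. by move=> hP ik; rewrite /cholesky schur_iter_null_row ?ik ?mul0r. Qed.

(** This is what lets a factor of h take values in a space that may have finite
    dimension: a null basis vector is only ever given null coefficients. *)
Lemma cholesky_null h i k : psd_kernel h -> h k k = 0 -> cholesky h i k = 0.
Proof.
move=> hP k0; rewrite /cholesky (@schur_iter_null_row h k k k)//.
  by rewrite sqrtr0 invr0 mulr0.
by rewrite k0 eqxx orbT.
Qed.

Lemma cholesky_step h n i j : psd_kernel h ->
  schur_iter h n i j =
  cholesky h i n * (cholesky h j n)^*%C + schur_iter h n.+1 i j.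
Proof.
move=> hP /=; rewrite /cholesky /schur; set g := schur_iter h n.
have gP : psd_kernel g by exact: schur_iter_psd.
rewrite rmorphM /= conjc_real -(psd_hermitian j n gP).
have gnn := psd_diag_ge0 n gP.
have -> : (g n n)^-1 = ((Num.sqrt (Re (g n n)))^-1)%:C ^+ 2.
  rewrite {1}(ge0_complex gnn) -fmorphV -rmorphXn /= exprVn sqr_sqrtr//.
  by move: gnn; rewrite ge0_complexE => /andP[].
set q := real_complex R _.
by rewrite expr2; ring.
Qed.

(** Each Schur complement subtracts one rank-one term; after n > i steps nothing
    is left in row i. *)
Lemma choleskyE h n i j : psd_kernel h -> (i < n)%N ->
  \sum_(k < n) cholesky h i k * (cholesky h j k)^*%C = h i j.
Proof.
move=> hP ltin; suff hE m : h i j =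
    \sum_(k < m) cholesky h i k * (cholesky h j k)^*%C + schur_iter h m i j.
  by rewrite [RHS](hE n) schur_iter_null_row ?ltin// addr0.
elim: m => [|m IHm]; first by rewrite big_ord0 add0r.
by rewrite big_ord_recr -addrA -cholesky_step.
Qed.

End psd_kernels.

(** * Densities of complex set functions *)

Section complex_measurability.
Context d (Omega : measurableType d) (R : realType).
Implicit Types f g : Omega -> R[i].

Lemma cmeasurable_cst (c : R[i]) : cmeasurable (fun _ : Omega => c).
Proof. by []. Qed.

Lemma cmeasurable_real (f : Omega -> R) :
  measurable_fun setT f -> cmeasurable (fun t => (f t)%:C).
Proof. by []. Qed.

Lemma cmeasurableD f g :
  cmeasurable f -> cmeasurable g -> cmeasurable (fun t => f t + g t).
Proof.
move=> [fr fi] [gr gi]; split.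
  by under eq_fun do rewrite ReD; exact: measurable_funD.
by under eq_fun do rewrite ImD; exact: measurable_funD.
Qed.

Lemma cmeasurableM f g :
  cmeasurable f -> cmeasurable g -> cmeasurable (fun t => f t * g t).
Proof.
move=> [fr fi] [gr gi]; split.
  by under eq_fun do rewrite ReM; apply: measurable_funB;
     exact: measurable_funM.
by under eq_fun do rewrite ImM; apply: measurable_funD; exact: measurable_funM.
Qed.

Lemma cmeasurableN f : cmeasurable f -> cmeasurable (fun t => - f t).
Proof.
move=> fm; under eq_fun do rewrite -mulN1r.
exact: cmeasurableM (cmeasurable_cst _) fm.
Qed.

Lemma cmeasurable_sum I (s : seq I) (f : I -> Omega -> R[i]) :
  (forall i, cmeasurable (f i)) -> cmeasurable (fun t => \sum_(i <- s) f i t).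
Proof.
move=> fm; elim: s => [|i s IHs].
  by under eq_fun do rewrite big_nil; exact: cmeasurable_cst.
by under eq_fun do rewrite big_cons; exact: cmeasurableD.
Qed.

Lemma measurable_inv_sqrt (f : Omega -> R) : (forall t, 0 <= f t) ->
  measurable_fun setT f -> measurable_fun setT (fun t => (Num.sqrt (f t))^-1).
Proof.
move=> f0 fm; under eq_fun do rewrite -powR12_sqrt// -powRN.
exact: measurableT_comp (measurable_powR _) fm.
Qed.

End complex_measurability.

Section real_densities.
Context d (Omega : measurableType d) (R : realType).
Variable mu : {measure set Omega -> \bar R}.

Lemma integrable_setTS (f : Omega -> \bar R) E :
  mu.-integrable setT f -> measurable E -> mu.-integrable E f.
Proof. by move=> fi mE; exact: integrableS fi. Qed.

(** On the set where f < 0, the integral of |f| is minus that of f, so it is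
    nonpositive. *)
Lemma Rintegral_ge0_ae (f : Omega -> R) : mu.-integrable setT (EFin \o f) ->
  (forall E, measurable E -> 0 <= Rintegral mu E f) ->
  {ae mu, forall t, 0 <= f t}.
Proof.
move=> fi f0; have fm : measurable_fun setT f.
  by apply/measurable_EFinP; exact: measurable_int fi.
pose N := [set t | f t < 0].
have mN : measurable N.
  by rewrite -[N]setTI; exact: measurable_fun_ltr.
have fiN : mu.-integrable N (EFin \o f) by exact: integrableS fi.
have fN0 : (\int[mu]_(t in N) `|(f t)%:E| = 0)%E.
  apply/eqP; rewrite eq_le integral_ge0 ?andbT; last by move=> t _.
  rewrite (eq_integral (fun t => - (f t)%:E)%E); last first.
    by move=> t /set_mem /= ft; rewrite ltr0_norm// EFinN.
  rewrite integralN/=; last first.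
    exact: integrable_add_def.
  have -> : (\int[mu]_(t in N) (f t)%:E)%E = (Rintegral mu N f)%:E.
    by rewrite fineK//; exact: integrable_fin_num.
  by rewrite -EFinN lee_fin oppr_le0; exact: f0.
have : ae_eq mu N (EFin \o f) (cst 0%E).
  by apply/ae_eq_integral_abs => //; exact: measurable_int fiN.
apply: filterS => t /= ft; rewrite leNgt; apply/negP => tN.
have [ft0] := ft tN.
by move: tN; rewrite ft0 ltxx.
Qed.

Lemma Rintegral_off_null (f : Omega -> R) N : measurable N -> mu N = 0 ->
  mu.-integrable setT (EFin \o f) ->
  let g t := \1_(~` N) t * f t in
  mu.-integrable setT (EFin \o g) /\
  forall E, measurable E -> Rintegral mu E g = Rintegral mu E f.
Proof.
move=> mN N0 fi g; have fm : measurable_fun setT f.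
  by apply/measurable_EFinP; exact: measurable_int fi.
have gm : measurable_fun setT g.
  by apply: measurable_funM => //; apply: measurable_indic; exact: measurableC.
split.
  apply: le_integrable fi => //; first exact/measurable_EFinP.
  move=> t _ /=; rewrite lee_fin /g indicE normrM ler_piMl//.
  by case: (_ \in _); rewrite ?normr0 ?normr1.
move=> E mE; congr fine; apply: ae_eq_integral => //.
- by apply/measurable_EFinP; exact: measurable_funTS.
- by apply/measurable_EFinP; exact: measurable_funTS.
- exists N; split => // t /= /not_implyP[_].
  apply: contra_notP => tN.
  by rewrite /g indicE mem_set// mul1r.
Qed.

End real_densities.

Section complex_densities.
Context d (Omega : measurableType d) (R : realType).
Variable mu : {measure set Omega -> \bar R}.
Implicit Types (f g : Omega -> R[i]) (nu : set Omega -> R[i]).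

Definition cintegrable f :=
  mu.-integrable setT (EFin \o (@Re R \o f)) /\
  mu.-integrable setT (EFin \o (@Im R \o f)).

Definition is_cdensity f nu := [/\ cmeasurable f, cintegrable f
  & forall E, measurable E -> cintegral mu E f = nu E].

Lemma is_cdensityD f g nu eta : is_cdensity f nu -> is_cdensity g eta ->
  is_cdensity (fun t => f t + g t) (fun E => nu E + eta E).
Proof.
move=> [fm [fr fi] fE] [gm [gr gi] gE]; split.
- exact: cmeasurableD.
- split.
    rewrite (_ : EFin \o _ =
        (EFin \o (@Re R \o f)) \+ (EFin \o (@Re R \o g)))%E; last first.
      by apply/funext => t /=; rewrite ReD EFinD.
    exact: integrableD.
  rewrite (_ : EFin \o _ =
      (EFin \o (@Im R \o f)) \+ (EFin \o (@Im R \o g)))%E; last first.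
    by apply/funext => t /=; rewrite ImD EFinD.
  exact: integrableD.
- move=> E mE; rewrite -fE// -gE// /cintegral.
  under [fun t => Re _]eq_fun do rewrite ReD.
  under [fun t => Im _]eq_fun do rewrite ImD.
  by rewrite !RintegralD//; exact: integrable_setTS.
Qed.

Lemma is_cdensityZ (a : R[i]) f nu : is_cdensity f nu ->
  is_cdensity (fun t => a * f t) (fun E => a * nu E).
Proof.
move=> [fm [fr fi] fE].
have ir b c : mu.-integrable setT
    (EFin \o (fun t => b * Re (f t) + c * Im (f t))).
  rewrite (_ : EFin \o _ =
      (fun t => b%:E * (Re (f t))%:E) \+ (fun t => c%:E * (Im (f t))%:E))%E//.
  by apply: integrableD => //; exact: integrableZl.
have iE b c E : measurable E -> Rintegral mu E
    (fun t => b * Re (f t) + c * Im (f t)) =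
    b * Rintegral mu E (@Re R \o f) + c * Rintegral mu E (@Im R \o f).
  move=> mE; rewrite RintegralD//; last 2 first.
  - have := integrable_setTS (ir b 0) mE.
    by apply: eq_integrable => // t _ /=; rewrite mul0r addr0.
  - have := integrable_setTS (ir 0 c) mE.
    by apply: eq_integrable => // t _ /=; rewrite mul0r add0r.
  by rewrite !RintegralZl//; exact: integrable_setTS.
have reE : (fun t => Re (a * f t)) =
    (fun t => Re a * Re (f t) + (- Im a) * Im (f t)).
  by apply/funext => t; rewrite ReM mulNr.
have imE : (fun t => Im (a * f t)) =
    (fun t => Im a * Re (f t) + Re a * Im (f t)).
  by apply/funext => t; rewrite ImM addrC.
split.
- by apply: cmeasurableM => //; exact: cmeasurable_cst.
- have ri := ir (Re a) (- Im a); have ii := ir (Im a) (Re a).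
  by rewrite -reE in ri; rewrite -imE in ii.
- move=> E mE; rewrite -fE// /cintegral reE imE !iE//.
  by apply: complexP; rewrite ?ReM ?ImM /=; ring.
Qed.

Lemma is_cdensity0 : is_cdensity (fun=> 0) (fun=> 0).
Proof.
split; first exact: cmeasurable_cst.
  by split; exact: integrable0.
move=> E mE; rewrite /cintegral /Rintegral /= integral0.
by [].
Qed.

Lemma is_cdensity_sum I (s : seq I) (f : I -> Omega -> R[i])
    (nu : I -> set Omega -> R[i]) :
  (forall i, is_cdensity (f i) (nu i)) ->
  is_cdensity (fun t => \sum_(i <- s) f i t) (fun E => \sum_(i <- s) nu i E).
Proof.
move=> fnu; elim: s => [|i s IHs].
  under eq_fun do rewrite big_nil; under [X in is_cdensity _ X]eq_fun do
    rewrite big_nil.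
  exact: is_cdensity0.
under eq_fun do rewrite big_cons; under [X in is_cdensity _ X]eq_fun do
  rewrite big_cons.
exact: is_cdensityD.
Qed.

Lemma is_cdensity_off_null f nu N : measurable N -> mu N = 0 ->
  is_cdensity f nu -> is_cdensity (fun t => (\1_(~` N) t : R)%:C * f t) nu.
Proof.
move=> mN N0 [fm [fr fi] fE].
have [ri rE] := Rintegral_off_null mN N0 fr.
have [ii iE] := Rintegral_off_null mN N0 fi.
have reE : (fun t => Re ((\1_(~` N) t : R)%:C * f t)) =
    (fun t => \1_(~` N) t * Re (f t)).
  by apply/funext => t; rewrite ReM /= mul0r subr0.
have imE : (fun t => Im ((\1_(~` N) t : R)%:C * f t)) =
    (fun t => \1_(~` N) t * Im (f t)).
  by apply/funext => t; rewrite ImM /= mul0r addr0.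
split.
- apply: cmeasurableM => //; apply: cmeasurable_real.
  by apply: measurable_indic; exact: measurableC.
- by rewrite -reE in ri; rewrite -imE in ii.
- by move=> E mE; rewrite -fE// /cintegral reE imE rE// iE.
Qed.

Lemma is_cdensity_ge0 f nu : is_cdensity f nu ->
  (forall E, measurable E -> 0 <= nu E) -> {ae mu, forall t, 0 <= f t}.
Proof.
move=> [fm [fr fi] fE] nu0.
have r0 : {ae mu, forall t, 0 <= Re (f t)}.
  apply: (Rintegral_ge0_ae fr) => E mE.
  by have := nu0 _ mE; rewrite -fE// ge0_complexE => /andP[].
have i0 : ae_eq mu setT (EFin \o (@Im R \o f)) (cst 0%E).
  apply: integral_ae_eq => // E _ mE; rewrite integral0.
  have /eqP : Rintegral mu E (@Im R \o f) == 0.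
    by have := nu0 _ mE; rewrite -fE// ge0_complexE => /andP[].
  rewrite /Rintegral => h; rewrite -[LHS]fineK; first by rewrite h.
  by apply: integrable_fin_num => //; exact: integrableS fi.
apply: filterS2 r0 i0 => t r /(_ I) [it]; rewrite ge0_complexE.
by rewrite r it eqxx.
Qed.

End complex_densities.

(** * The scalar measures of a POVM *)

Section finite_measures.
Context d (Omega : measurableType d) (R : realType).

(** A weighted sum of the measures, with weights making the total mass at most
    1. *)
Lemma common_dominating_measure
    (nu : nat -> {finite_measure set Omega -> \bar R}) :
  exists mu : {finite_measure set Omega -> \bar R}, forall n, nu n `<< mu.
Proof.
pose r n := fine (nu n setT).
have r0 n : 0 <= r n by rewrite fine_ge0.
pose c n : {nonneg R} := NngNum (divr_ge0 ler01
  (mulr_ge0 (ler0n R (2 ^ n.+1)) (addr_ge0 ler01 (r0 n)))).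
have cE n : (c n)%:num = 1 / (2 ^ n.+1)%:R / (1 + r n).
  by rewrite /c /= invfM mulrA.
pose mu0 := mseries (fun n => mscale (c n) (nu n)) 0.
have mu0_fin : fin_num_fun mu0.
  move=> E mE; rewrite ge0_fin_numE// (@le_lt_trans _ _ 1%E)//;
    last exact: ltry.
  apply: le_trans (@epsilon_trick0 R 1 xpredT ler01).
  apply: lee_nneseries => // n _.
  rewrite /mscale /= [X in (_ * X <= _)%E](_ : _ = (fine (nu n E))%:E);
    last first.
    by rewrite fineK// fin_num_measure.
  rewrite -EFinM lee_fin cE mulrAC ler_pdivrMr ?ltr_pwDl// ler_wpM2l//.
  have : fine (nu n E) <= r n.
    by rewrite fine_le ?fin_num_measure// le_measure ?inE.
  by move/le_trans; apply; rewrite lerDr.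
pose mu : {finite_measure set Omega -> \bar R} :=
  HB.pack mu0 (Measure_isFinite.Build _ _ _ mu0 mu0_fin).
exists mu => n; apply/null_content_dominatesP => A mA muA0.
have : ((c n)%:num%:E * nu n A <= 0)%E.
  rewrite -muA0 [leRHS](@nneseriesD1 _ _ n xpredT)//.
  by rewrite leeDl// nneseries_ge0.
by rewrite pmule_rle0 ?lte_fin ?cE ?divr_gt0 ?mulr_gt0 ?ltr_pwDl//
  measure_le0 => /eqP.
Qed.

Lemma finite_measure_density (mu nu : {finite_measure set Omega -> \bar R}) :
  nu `<< mu -> exists f : Omega -> R,
  [/\ mu.-integrable setT (EFin \o f) &
    forall E, measurable E -> nu E = (\int[mu]_(t in E) (f t)%:E)%E].
Proof.
move=> /radon_nikodym_sigma_finite[f [f0 ffin fi fE]].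
have fEf : EFin \o (fine \o f) = f by apply/funext => t /=; rewrite fineK.
exists (fine \o f); split; first by rewrite fEf.
by move=> E /fE ->; apply: eq_integral => t _ /=; rewrite fineK.
Qed.

End finite_measures.

Lemma cvg_Re (R : realType) (u : nat -> R[i]) (l : R[i]) :
  (u : nat -> R[i]^o) @ \oo --> (l : R[i]^o) ->
  Re (u n) @[n --> \oo] --> Re l.
Proof.
move=> /cvgrPdist_lt ul; apply/cvgrPdist_lt => e e0.
have e0' : 0 < e%:C :> R[i] by rewrite ltcR.
near=> n; rewrite -ReB (le_lt_trans (norm_Re _))//.
have : `|l - u n| < e%:C by near: n; exact: ul.
by rewrite ltcE => /andP[].
Unshelve. all: by end_near. Qed.

Section povm_measures.
Context d (Omega : measurableType d) (R : realType) (H : hilbertType R).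
Context (M : set Omega -> {linear H -> H}).
Context (povmM : is_povm M).

Lemma povm_ge0 E x : measurable E -> 0 <= inner (M E x) x.
Proof. by have [+ _ _] := povmM => /[apply] -[_]; exact. Qed.

Lemma povm_form_real E x : measurable E ->
  inner (M E x) x = (Re (inner (M E x) x))%:C.
Proof. by move=> mE; rewrite -ge0_complex// povm_ge0. Qed.

(** The absolute value keeps this set function nonnegative on the sets outside
    the sigma-algebra, where the operators are arbitrary. *)
Definition povm_quad & is_povm M := fun (x : H) (E : set Omega) =>
  (`|Re (inner (M E x) x)|)%:E.

Let povm_quadE x E : measurable E ->
  povm_quad povmM x E = (Re (inner (M E x) x))%:E.
Proof.
move=> mE; rewrite /povm_quad ger0_norm//.
by have := povm_ge0 x mE; rewrite ge0_complexE => /andP[].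
Qed.

Let povm_quad0 x : povm_quad povmM x set0 = 0%E.
Proof.
by rewrite povm_quadE//; have [_ -> _] := povmM; rewrite inner0l.
Qed.

Let povm_quad_ge0 x E : (0 <= povm_quad povmM x E)%E.
Proof. by rewrite lee_fin. Qed.

Let povm_quad_sigma_additive x : semi_sigma_additive (povm_quad povmM x).
Proof.
move=> F mF tF mUF; rewrite povm_quadE//.
under eq_fun => n do
  rewrite (eq_bigr _ (fun i _ => povm_quadE x (mF i))) sumEFin.
apply/fine_cvgP; split; first by near=> n.
have [_ _ /(_ F x x mF tF)/cvg_Re] := povmM.
apply: cvg_trans; apply: near_eq_cvg; near=> n.
by rewrite /= Re_sum.
Unshelve. all: by end_near. Qed.

HB.instance Definition _ x := isMeasure.Build _ _ _ (povm_quad povmM x)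
  (povm_quad0 x) (povm_quad_ge0 x) (@povm_quad_sigma_additive x).

Let povm_quad_fin x : fin_num_fun (povm_quad povmM x).
Proof. by []. Qed.

HB.instance Definition _ x := @Measure_isFinite.Build _ _ _ (povm_quad povmM x)
  (@povm_quad_fin x).

(** Only the real part enters: the diagonal values of a POVM are nonnegative
    reals. *)
Lemma povm_measure : exists nu : H -> {finite_measure set Omega -> \bar R},
  forall x E, measurable E -> nu x E = (Re (inner (M E x) x))%:E.
Proof.
by exists (fun x => povm_quad povmM x : {finite_measure set Omega -> \bar R}).
Qed.

End povm_measures.

(** * The density kernel of a POVM *)

Section componentwise_limits.
Context (R : realType).
Implicit Types (u w : nat -> R[i]) (a b : R[i]).

(** Convergence of both coordinates, which is all that polynomial expressions
    need. *)
Definition ccvg u a :=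
  (Re (u n) @[n --> \oo] --> Re a) /\ (Im (u n) @[n --> \oo] --> Im a).

Lemma ccvg_cst a : ccvg (fun=> a) a.
Proof. by split; exact: cvg_cst. Qed.

Lemma ccvgD u w a b : ccvg u a -> ccvg w b -> ccvg (fun n => u n + w n) (a + b).
Proof.
move=> [ur ui] [wr wi]; split.
  by under eq_fun do rewrite ReD; rewrite ReD; exact: cvgD.
by under eq_fun do rewrite ImD; rewrite ImD; exact: cvgD.
Qed.

Lemma ccvgM u w a b : ccvg u a -> ccvg w b -> ccvg (fun n => u n * w n) (a * b).
Proof.
move=> [ur ui] [wr wi]; split.
  by under eq_fun do rewrite ReM; rewrite ReM; apply: cvgB; exact: cvgM.
by under eq_fun do rewrite ImM; rewrite ImM; apply: cvgD; exact: cvgM.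
Qed.

Lemma ccvgJ u a : ccvg u a -> ccvg (fun n => (u n)^*%C) a^*%C.
Proof.
move=> [ur ui]; split; first by under eq_fun do rewrite ReJ; rewrite ReJ.
by under eq_fun do rewrite ImJ; rewrite ImJ; exact: cvgN.
Qed.

Lemma ccvg_sum I (s : seq I) (u : I -> nat -> R[i]) (a : I -> R[i]) :
  (forall i, ccvg (u i) (a i)) ->
  ccvg (fun n => \sum_(i <- s) u i n) (\sum_(i <- s) a i).
Proof.
move=> ua; elim: s => [|i s IHs].
  by under eq_fun do rewrite big_nil; rewrite big_nil; exact: ccvg_cst.
by under eq_fun do rewrite big_cons; rewrite big_cons; exact: ccvgD.
Qed.

Lemma ccvg_ge0 u a : ccvg u a -> (forall n, 0 <= u n) -> 0 <= a.
Proof.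
move=> [ur ui] u0; rewrite ge0_complexE; apply/andP; split; last first.
  apply: (cvgr_to_ge ur); apply: nearW => n.
  by have := u0 n; rewrite ge0_complexE => /andP[].
have im0 : (fun n => Im (u n)) = fun=> 0.
  apply/funext => n.
  by have := u0 n; rewrite ge0_complexE => /andP[/eqP].
rewrite im0 in ui; rewrite eq_sym; apply/eqP.
by apply: cvg_unique ui => //; exact: cvg_cst.
Qed.

Definition crat (q : rat * rat) : R[i] := ratr q.1 +i* ratr q.2.

Lemma rat_approx (x : R) : exists q : nat -> rat,
  ratr (q n) @[n --> \oo] --> x.
Proof.
have qP n : exists q : rat, ratr q \in `]x, x + n.+1%:R^-1[.
  by apply: rat_in_itvoo; rewrite ltrDl invr_gt0.
have [q {}qP] := choice qP; exists q.
apply/cvgrPdist_lt => e e0.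
near=> n.
have := qP n; rewrite in_itv /= => /andP[q1 q2].
rewrite distrC ger0_norm ?subr_ge0 ?ltW// ltrBlDl (lt_trans q2)// ltrD2l.
near: n; exact: near_infty_natSinv_lt (PosNum e0).
Unshelve. all: by end_near. Qed.

Lemma crat_approx a : exists q : nat -> rat * rat, ccvg (crat \o q) a.
Proof.
have [q qa] := rat_approx (Re a); have [p pa] := rat_approx (Im a).
by exists (fun n => (q n, p n)).
Qed.

(** The form is continuous in the coefficients, so that countably many
    inequalities suffice for positivity; this makes positivity an almost
    everywhere property. *)
Lemma psd_kernel_rational (h : nat -> nat -> R[i]) :
  (forall s : seq (rat * rat * nat),
    let s' := [seq (crat p.1, p.2) | p <- s] in 0 <= kernel_form h s' s') ->
  psd_kernel h.
Proof.
move=> hP s.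
have [q qP] := choice crat_approx.
apply: (@ccvg_ge0 (fun n => kernel_form h
    [seq (crat p.1, p.2) | p <- [seq (q p.1 n, p.2) | p <- s]]
    [seq (crat p.1, p.2) | p <- [seq (q p.1 n, p.2) | p <- s]])) => //.
rewrite /kernel_form; under eq_fun do rewrite !big_map.
apply: ccvg_sum => a.
under eq_fun do rewrite !big_map.
apply: ccvg_sum => b /=.
apply: ccvgM; last exact: ccvg_cst.
by apply: ccvgM; [exact: qP|apply: ccvgJ; exact: qP].
Qed.

End componentwise_limits.

Definition lincomb (R : realType) (V : lmodType R[i]) (e : nat -> V)
    (s : seq (R[i] * nat)) : V :=
  \sum_(a <- s) a.1 *: e a.2.

Lemma ae_countType d (T : sigmaRingType d) (R : realType)
    (mu : {measure set T -> \bar R}) (I : countType) (P : I -> T -> Prop) :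
  (forall i, {ae mu, forall t, P i t}) -> {ae mu, forall t i, P i t}.
Proof.
move=> aeP.
have : {ae mu, forall t, forall n,
    if unpickle n is Some i then P i t else True}.
  apply: ae_foralln => n; case: (unpickle n) => [i|]; first exact: aeP.
  exact: aeW.
by apply: filterS => t Pt i; have := Pt (pickle i); rewrite pickleK.
Qed.

(** The polarization identity with its sixteen terms written out, in an abstract
    field with a square root i of -1. *)
Lemma polarization_identity (F : fieldType) (i q xx xy yx yy : F) :
  i * i = - 1 -> 4 * q = 1 ->
  xy = q * (xx + xy + (yx + yy) + - 1 * (xx - xy - (yx - yy)) +
    i * (xx + - i * xy + (i * yx + i * (- i * yy))) +
    - i * (xx - - i * xy - (i * yx - i * (- i * yy)))).
Proof. by move=> i2 q4; ring: i2 q4. Qed.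

Section povm_kernel.
Context d (Omega : measurableType d) (R : realType) (H : hilbertType R).
Context (M : set Omega -> {linear H -> H}).
Context (povmM : is_povm M).

Lemma povm_form_lincomb (e : nat -> H) E s :
  inner (M E (lincomb e s)) (lincomb e s) =
  kernel_form (fun i j => inner (M E (e i)) (e j)) s s.
Proof.
have -> : M E (lincomb e s) = \sum_(a <- s) a.1 *: M E (e a.2).
  by rewrite /lincomb linear_sum; apply: eq_bigr => a _; rewrite linearZ.
rewrite inner_suml; apply: eq_bigr => a _.
rewrite /lincomb inner_sumr; apply: eq_bigr => b _.
by rewrite innerZl innerZr mulrA.
Qed.

Let MD E x y : M E (x + y) = M E x + M E y. Proof. exact: linearD. Qed.
Let MN E x : M E (- x) = - M E x. Proof. exact: linearN. Qed.
Let MZ E a x : M E (a *: x) = a *: M E x. Proof. exact: linearZ. Qed.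

Lemma povm_polarization E x y : inner (M E x) y =
  (4^-1)%:C * (inner (M E (x + y)) (x + y) +
    - 1 * inner (M E (x - y)) (x - y) +
    'i%C * inner (M E (x + 'i%C *: y)) (x + 'i%C *: y) +
    - 'i%C * inner (M E (x - 'i%C *: y)) (x - 'i%C *: y)).
Proof.
have ci : ('i%C)^*%C = - 'i%C :> R[i] by apply: complexP; rewrite /= ?oppr0.
have i2 : 'i%C * 'i%C = -1 :> R[i] by rewrite -expr2 sqr_i.
have q4 : 4 * (4^-1)%:C = 1 :> R[i].
  by rewrite fmorphV rmorph_nat mulfV// pnatr_eq0.
rewrite !MD !MN !MZ !(innerDl, innerDr, innerNl, innerNr, innerZl, innerZr) ci.
exact: polarization_identity i2 q4.
Qed.

(** The parallelogram law bounds the measure of x + y by twice the sum of the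
    measures of x and y. *)
Lemma povm_null (mu : {measure set Omega -> \bar R}) (e : nat -> H)
    (nu : H -> {finite_measure set Omega -> \bar R}) i j (c : R[i]) :
  (forall x E, measurable E -> nu x E = (Re (inner (M E x) x))%:E) ->
  (forall n, nu (e n) `<< mu) -> nu (e i + c *: e j) `<< mu.
Proof.
move=> nuE numu; apply/null_content_dominatesP => A mA A0.
have null x : x = e i \/ x = e j -> Re (inner (M A x) x) = 0.
  move=> xE; have : nu x `<< mu by case: xE => ->.
  move=> /null_content_dominatesP/(_ A mA A0).
  by rewrite nuE// => -[].
have nonneg x : 0 <= Re (inner (M A x) x).
  by have := povm_ge0 povmM x mA; rewrite ge0_complexE => /andP[].
rewrite nuE//; congr _%:E.
have hi := null _ (or_introl erefl); have hj := null _ (or_intror erefl).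
have hj' : Re (inner (M A (c *: e j)) (c *: e j)) = 0.
  rewrite MZ innerZl innerZr mulrA ReM hj mulr0 sub0r.
  rewrite (ger0_Im (povm_ge0 povmM (e j) mA)).
  by rewrite mulr0 oppr0.
have := nonneg (e i + c *: e j); have := nonneg (e i - c *: e j).
move: hj'; set y := c *: e j => hj'.
rewrite !MD !MN !(innerDl, innerDr, innerNl, innerNr, ReD, ReN).
rewrite hi hj'; lra.
Qed.

(** The measures of the e_i and of the e_i + c e_j with c in {1, -1, i, -i} have
    densities with respect to one finite measure, and polarization combines them
    into densities h i j. For each list of rational coefficients the form of h
    is the density of a nonnegative measure, hence it is nonnegative almost
    everywhere. Finally h is set to 0 on the exceptional null set. *)
Lemma povm_kernel (e : nat -> H) :
  exists (mu : {finite_measure set Omega -> \bar R})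
         (h : nat -> nat -> Omega -> R[i]),
  [/\ forall t, psd_kernel (fun i j => h i j t),
      forall i t, e i = 0 -> h i i t = 0
    & forall i j,
        is_cdensity mu (h i j) (fun E => inner (M E (e i)) (e j))].
Proof.
have [nu nuE] := povm_measure povmM.
have [mu numu] := common_dominating_measure (fun n => nu (e n)).
have dens i j c : exists f, is_cdensity mu f
    (fun E => inner (M E (e i + c *: e j)) (e i + c *: e j)).
  have [f [fi fE]] := finite_measure_density (povm_null i j c nuE numu).
  have fm : measurable_fun setT f.
    by apply/measurable_EFinP; exact: measurable_int fi.
  exists (fun t => (f t)%:C); split.
  - exact: cmeasurable_real.
  - by split => //; exact: integrable0.
  - move=> E mE; rewrite povm_form_real//.
    rewrite /cintegral /Rintegral /= integral0 -fE// nuE//.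
have {}dens i j : exists f,
    is_cdensity mu f (fun E => inner (M E (e i)) (e j)).
  have [f1 f1P] := dens i j 1; have [f2 f2P] := dens i j (- 1).
  have [f3 f3P] := dens i j 'i%C; have [f4 f4P] := dens i j (- 'i%C).
  have := is_cdensityZ (4^-1)%:C (is_cdensityD (is_cdensityD (is_cdensityD f1P
    (is_cdensityZ (- 1) f2P)) (is_cdensityZ 'i%C f3P))
    (is_cdensityZ (- 'i%C) f4P)).
  under [X in is_cdensity _ _ X -> _]eq_fun => E do
    rewrite scale1r scaleN1r scaleNr -povm_polarization.
  by move=> fP; eexists; exact: fP.
have [h0 h0P] := choice (fun ij => dens ij.1 ij.2).
have [N [mN N0 NP]] : {ae mu, forall t,
    psd_kernel (fun i j => h0 (i, j) t) /\
    (forall i, e i = 0 -> h0 (i, i) t = 0)}.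
  apply: filterI.
    have : {ae mu, forall t, forall s : seq (rat * rat * nat),
        let s' := [seq (crat R a.1, a.2) | a <- s] in
        0 <= kernel_form (fun i j => h0 (i, j) t) s' s'}.
      apply: ae_countType => s /=; set s' := [seq _ | _ <- s].
      apply: (@is_cdensity_ge0 _ _ _ _ _
          (fun E => kernel_form (fun i j => inner (M E (e i)) (e j)) s' s')).
        apply: is_cdensity_sum => a; apply: is_cdensity_sum => b.
        by apply: is_cdensityZ; exact: h0P (a.2, b.2).
      by move=> E mE; rewrite -povm_form_lincomb povm_ge0.
    by apply: filterS => t; exact: psd_kernel_rational.
  apply: (ae_foralln (P := fun i t => e i = 0 -> h0 (i, i) t = 0)) => i.
  have [ei|ei] := pselect (e i = 0); last by apply: aeW.
  have h0i (c : R[i]) : {ae mu, forall t, 0 <= c * h0 (i, i) t}.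
    have := is_cdensityZ c (h0P (i, i)); move=> /is_cdensity_ge0; apply => E _.
    by rewrite /= ei inner0r mulr0.
  apply: filterS2 (h0i 1) (h0i (- 1)) => t; rewrite mul1r mulN1r oppr_ge0.
  by move=> p q _; apply/eqP; rewrite eq_le p q.
exists mu, (fun i j t => (\1_(~` N) t : R)%:C * h0 (i, j) t); split.
- move=> t s; have [tN|tN] := pselect (N t).
    rewrite /kernel_form big1 // => a _; rewrite big1 // => b _.
    by rewrite indicE memNset// mul0r mulr0.
  have [+ _] : psd_kernel (fun i j => h0 (i, j) t) /\
      (forall i, e i = 0 -> h0 (i, i) t = 0) by apply: contrapT => /NP.
  rewrite indicE mem_set// /psd_kernel => /(_ s).
  by under [X in kernel_form X]eq_fun => i do
    under eq_fun => j do rewrite -[h0 _ _]mul1r.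
- move=> i t ei; have [tN|tN] := pselect (N t).
    by rewrite indicE memNset// mul0r.
  have [_ ->//] : psd_kernel (fun i j => h0 (i, j) t) /\
      (forall i, e i = 0 -> h0 (i, i) t = 0) by apply: contrapT => /NP.
  by rewrite mulr0.
- by move=> i j; apply: is_cdensity_off_null => //; exact: h0P (i, j).
Qed.

End povm_kernel.

(** * Measurable vector fields *)

Section vector_fields.
Context d (Omega : measurableType d) (R : realType) (H : hilbertType R).
Implicit Types (u v w : Omega -> H).

(** For separable H, a measurable family with all fibres equal to H that
    contains the constant fields consists of exactly these fields. *)
Definition weakly_measurable u :=
  forall y : H, cmeasurable (fun t => inner (u t) y).

Lemma weakly_measurable_cst (x : H) : weakly_measurable (fun=> x).
Proof. by move=> y; exact: cmeasurable_cst. Qed.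

Lemma weakly_measurable_linear (a : R[i]) u v :
  weakly_measurable u -> weakly_measurable v ->
  weakly_measurable (fun t => a *: u t + v t).
Proof.
move=> um vm y; under eq_fun do rewrite innerDl innerZl.
by apply: cmeasurableD => //; apply: cmeasurableM => //; exact: cmeasurable_cst.
Qed.

Lemma weakly_measurableB u v : weakly_measurable u -> weakly_measurable v ->
  weakly_measurable (fun t => u t - v t).
Proof.
move=> um vm; under eq_fun do rewrite addrC -scaleN1r.
exact: weakly_measurable_linear.
Qed.

Lemma weakly_measurableZ (f : Omega -> R[i]) u :
  cmeasurable f -> weakly_measurable u ->
  weakly_measurable (fun t => f t *: u t).
Proof.
by move=> fm um y; under eq_fun do rewrite innerZl; exact: cmeasurableM.
Qed.

Lemma weakly_measurable_sum I (s : seq I) (u : I -> Omega -> H) :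
  (forall i, weakly_measurable (u i)) ->
  weakly_measurable (fun t => \sum_(i <- s) u i t).
Proof.
move=> um y; under eq_fun do rewrite inner_suml.
by apply: cmeasurable_sum => i; exact: um.
Qed.

Lemma sqr_rnormB (x y : H) :
  rnorm (x - y) ^+ 2 = rnorm x ^+ 2 - 2 * Re (inner x y) + rnorm y ^+ 2.
Proof.
rewrite !rnorm_sqr !(innerDl, innerDr, innerNl, innerNr, ReD, ReN).
by rewrite (innerC x y) ReJ; ring.
Qed.

(** For a dense sequence z, the square of the norm of x is the supremum of
    2 Re <x, z n> - |z n|^2, because |x - z n|^2 can be made as small as
    wanted. *)
Lemma measurable_sqr_rnorm u : separable_space H -> weakly_measurable u ->
  measurable_fun setT (fun t => rnorm (u t) ^+ 2).
Proof.
move=> /separable_dense_seq[z zP] um.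
pose h n t := 2 * Re (inner (u t) (z n)) - rnorm (z n) ^+ 2.
have h_le n t : h n t <= rnorm (u t) ^+ 2.
  by have := sqr_ge0 (rnorm (u t - z n)); rewrite sqr_rnormB /h; lra.
have hub t : has_ubound (range (h ^~ t)).
  by exists (rnorm (u t) ^+ 2) => _ [n _ <-].
rewrite (_ : (fun _ => _) = (fun t => sups (h ^~ t) 0)).
  apply: measurable_fun_sups => // n.
  by apply: measurable_funB => //; apply: measurable_funM => //; exact: (um _).1.
apply/funext => t; apply/eqP; rewrite eq_le; apply/andP; split; last first.
  by apply: ge_sup; [exists (h 0%N t); exists 0%N|move=> _ [n _ <-]].
apply/ler_addgt0Pr => e e0.
pose r := Num.min e 1.
have r0 : 0 < r by rewrite lt_min e0 ltr01.
have [n un] := zP (u t) r r0.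
have r2 : rnorm (u t - z n) ^+ 2 <= e.
  have : rnorm (u t - z n) ^+ 2 <= r ^+ 2.
    by rewrite ler_sqr ?nnegrE ?rnorm_ge0 ?ltW.
  have r1 : r <= 1 by rewrite ge_min lexx orbT.
  have re : r <= e by rewrite ge_min lexx.
  by nra.
have : h n t <= sups (h ^~ t) 0.
  by apply: ub_le_sup; [exact: has_ubound_sdrop|exists n].
by move: r2; rewrite sqr_rnormB /h; lra.
Qed.

Lemma measurable_rnorm u : separable_space H -> weakly_measurable u ->
  measurable_fun setT (fun t => rnorm (u t)).
Proof.
move=> sH um.
rewrite (_ : (fun _ => _) = (fun t => (rnorm (u t) ^+ 2) `^ 2^-1)).
  exact: measurableT_comp (measurable_powR _) (measurable_sqr_rnorm sH um).
apply/funext => t; rewrite powR12_sqrt ?sqr_ge0// sqrtr_sqr ger0_norm//.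
exact: rnorm_ge0.
Qed.

End vector_fields.

Section norm_limits.
Context (R : realType) (H : hilbertType R).
Implicit Types (u : nat -> H) (w y : H).

Lemma ler_dist_rnorm (x y : H) : `|rnorm x - rnorm y| <= rnorm (x - y).
Proof.
rewrite ler_norml; apply/andP; split.
  have := rnormD (y - x) x; rewrite subrK -opprB rnormN => h; lra.
by have := rnormD (x - y) y; rewrite subrK => h; lra.
Qed.

Lemma cvg_rnormD u w y : rnorm (w - u n) @[n --> \oo] --> (0 : R) ->
  rnorm (u n + y) @[n --> \oo] --> rnorm (w + y).
Proof.
move=> /cvgrPdist_lt uw; apply/cvgrPdist_lt => e e0; near=> n.
rewrite (le_lt_trans (ler_dist_rnorm _ _))//.
have -> : w + y - (u n + y) = w - u n by rewrite opprD addrACA subrr addr0.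
have : `|0 - rnorm (w - u n)| < e by near: n; exact: uw.
by rewrite sub0r normrN ger0_norm// rnorm_ge0.
Unshelve. all: by end_near. Qed.

Lemma cvg_sqr_rnormD u w y : rnorm (w - u n) @[n --> \oo] --> (0 : R) ->
  rnorm (u n + y) ^+ 2 @[n --> \oo] --> rnorm (w + y) ^+ 2.
Proof. by move=> uw; apply: cvgM; exact: cvg_rnormD. Qed.

Lemma cvg_Re_inner u w y : rnorm (w - u n) @[n --> \oo] --> (0 : R) ->
  Re (inner (u n) y) @[n --> \oo] --> Re (inner w y).
Proof.
move=> uw; rewrite Re_inner_polar; under eq_fun do rewrite Re_inner_polar.
apply: cvgM; last exact: cvg_cst.
by apply: cvgB; exact: cvg_sqr_rnormD.
Qed.

Lemma cvg_Im_inner u w y : rnorm (w - u n) @[n --> \oo] --> (0 : R) ->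
  Im (inner (u n) y) @[n --> \oo] --> Im (inner w y).
Proof.
by move=> uw; rewrite -Re_innerZi; under eq_fun do rewrite -Re_innerZi;
  exact: cvg_Re_inner.
Qed.

Lemma rnorm_telescope u m n (f : nat -> R) : (m <= n)%N ->
  (forall i, rnorm (u i.+1 - u i) <= f i - f i.+1) ->
  rnorm (u n - u m) <= f m - f n.
Proof.
move=> + uf; elim: n => [|n IHn].
  by rewrite leqn0 => /eqP ->; rewrite subrr rnorm0 subrr.
rewrite leq_eqVlt => /predU1P[<-|]; first by rewrite subrr rnorm0 subrr.
rewrite ltnS => /IHn un; have := rnormD (u n.+1 - u n) (u n - u m).
by rewrite subrKA; have := uf n; lra.
Qed.

(** Completeness of H, with a real-valued modulus of convergence. *)
Lemma geometric_cvg u (b : R) :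
  (forall i, rnorm (u i.+1 - u i) <= b / 2 ^+ i) ->
  exists w, rnorm (w - u n) @[n --> \oo] --> (0 : R).
Proof.
move=> ub.
have b0 : 0 <= b.
  have := ub 0%N; rewrite expr0 divr1; apply: le_trans; exact: rnorm_ge0.
have uP m n : (m <= n)%N -> rnorm (u n - u m) <= 2 * b / 2 ^+ m.
  move=> mn.
  have := @rnorm_telescope u m n (fun i => 2 * b / 2 ^+ i) mn.
  have pos k : 0 <= 2 * b / 2 ^+ k by rewrite divr_ge0 ?mulr_ge0 ?exprn_ge0.
  move=> h; apply: le_trans (h _) _; last by have := pos n; lra.
  move=> i; apply: le_trans (ub i) _; rewrite le_eqVlt; apply/orP; left.
  apply/eqP; rewrite exprS; field.
  by rewrite expf_neq0.
have small (e : R) : 0 < e -> exists m, 2 * b / 2 ^+ m < e.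
  move=> e0.
  have : (2 * b) * (2^-1) ^+ n @[n --> \oo] --> (2 * b) * (0 : R).
    apply: cvgM; first exact: cvg_cst.
    apply: cvg_expr; rewrite ger0_norm// invf_lt1//.
    by rewrite ltr1n.
  rewrite mulr0 => /cvgrPdist_lt/(_ e e0)[m _ /(_ m (leqnn m))] /=.
  rewrite sub0r normrN => h; exists m; apply: le_lt_trans h.
  by rewrite exprVn ler_norm.
have : cvg (u @ \oo).
  apply: cauchy_cvg; apply: cauchy_exP => e e0.
  have ee : e = (Re e)%:C by apply: ge0_complex; exact: ltW.
  have [|m mP] := small (Re e); first by rewrite ee ltcR in e0.
  exists (u m); exists m => // n /= mn; rewrite -ball_normE /=.
  rewrite ee rnorm_complex ltcR -opprB rnormN.
  by apply: le_lt_trans mP; exact: uP.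
move=> /cvg_ex[/= w uw]; exists w; apply/cvgrPdist_lt => e e0.
have e0' : 0 < e%:C :> R[i] by rewrite ltcR.
move/cvgrPdist_lt : uw => /(_ _ e0'); apply: filterS => n.
by rewrite rnorm_complex ltcR sub0r normrN ger0_norm// rnorm_ge0.
Qed.

End norm_limits.

(** * Completeness of the space of square integrable fields *)

Section l2_completeness.
Context d (Omega : measurableType d) (R : realType) (H : hilbertType R).
Context (mu : {measure set Omega -> \bar R}).
Local Open Scope ereal_scope.

Lemma limn_einf_le_near (f : (\bar R)^nat) (c : \bar R) k :
  (forall j, (k <= j)%N -> f j <= c) -> limn_einf f <= c.
Proof.
move=> fc; rewrite limn_einf_lim; apply: lime_le; first exact: is_cvg_einfs.
apply: nearW => n; apply: le_trans (fc (maxn n k) (leq_maxr _ _)).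
by apply: ereal_inf_lbound; exists (maxn n k) => //=; exact: leq_maxl.
Qed.

Lemma limn_einf_cvg (f : (\bar R)^nat) l : f @ \oo --> l -> limn_einf f = l.
Proof. by move=> fl; have [-> _] := cvg_limn_einf_sup fl. Qed.

(** The bounds make the integral of B, the sum of the 4^k |u_(k+1) - u_k|^2,
    finite. Where B is finite, |u_(k+1) - u_k| is at most (B + 1) / 2^k, so u
    converges there; Fatou's lemma then bounds the integral of |w - u k|^2. *)
Lemma l2_complete (u : nat -> Omega -> H) : separable_space H ->
  (forall k, weakly_measurable (u k)) ->
  (forall k j, (k <= j)%N ->
    \int[mu]_t (rnorm (u j t - u k t) ^+ 2)%:E <=
      ((4 ^+ k)^-1 / (2 ^ k.+1)%:R)%:E) ->
  exists2 w, weakly_measurable w &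
    forall k, \int[mu]_t (rnorm (w t - u k t) ^+ 2)%:E <=
      ((4 ^+ k)^-1 / (2 ^ k.+1)%:R)%:E.
Proof.
move=> sH um uc.
have mB k j : measurable_fun setT (fun t => (rnorm (u j t - u k t) ^+ 2)%:E).
  by apply/measurable_EFinP; apply: measurable_sqr_rnorm => //;
    exact: weakly_measurableB.
have p4 k : (0 <= 4 ^+ k :> R)%R by rewrite exprn_ge0 ?ler0n.
have p4' k : (4 ^+ k != 0 :> R)%R by rewrite expf_neq0 ?pnatr_eq0.
have p2 k : (0 < 2 ^+ k :> R)%R by rewrite exprn_gt0 ?ltr0n.
pose a k t := (4 ^+ k)%:E * (rnorm (u k.+1 t - u k t) ^+ 2)%:E.
have a0 k t : 0 <= a k t.
  by apply: mule_ge0; rewrite lee_fin ?p4 ?sqr_ge0.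
have am k : measurable_fun setT (a k).
  exact: emeasurable_funM.
pose B t := \sum_(k <oo) a k t.
have B0 t : 0 <= B t by exact: nneseries_ge0.
have Bm : measurable_fun setT B.
  apply: (emeasurable_fun_cvg (fun n t => \sum_(0 <= k < n) a k t)).
    by move=> n; exact: emeasurable_sum.
  by move=> t _; apply: is_cvg_nneseries.
have Bint : \int[mu]_t B t < +oo.
  rewrite integral_nneseries//.
  apply: (@le_lt_trans _ _ 1%:E); last exact: ltry.
  apply: le_trans (@epsilon_trick0 R 1 xpredT ler01).
  apply: lee_nneseries => [k _ _|k _].
    by apply: integral_ge0 => t _; exact: a0.
  rewrite ge0_integralZl_EFin//; last by move=> t _; rewrite lee_fin sqr_ge0.
  apply: (@le_trans _ _ ((4 ^+ k)%:E * ((4 ^+ k)^-1 / (2 ^ k.+1)%:R)%:E)).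
    apply: lee_pmul => //; rewrite ?lee_fin ?p4// ?uc//.
    by apply: integral_ge0 => t _; rewrite lee_fin sqr_ge0.
  by rewrite -EFinM mulrA mulfV ?p4'.
pose G := [set t | B t < +oo].
have mG : measurable G.
  by rewrite -[G]setTI; exact: emeasurable_fun_infty_o.
have G0 : mu (~` G) = 0.
  have Bi : mu.-integrable setT B.
    apply/integrableP; split => //.
    by under eq_integral do rewrite gee0_abs//.
  have [N [mN N0 NB]] := integrable_ae measurableT Bi.
  apply: (subset_measure0 _ mN _ N0) => //; first exact: measurableC.
  by move=> t tG; apply: NB => /= /(_ Logic.I); rewrite ge0_fin_numE.
have cauchy t : G t -> exists w,
    (rnorm (w - u n t))%R @[n --> \oo] --> (0 : R)%R.
  move=> tG; pose b := fine (B t).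
  have Bb : B t = b%:E by rewrite fineK// ge0_fin_numE.
  have b0 : (0 <= b)%R by rewrite fine_ge0.
  apply: (@geometric_cvg _ _ (fun n => u n t) (b + 1)%R) => i.
  have : a i t <= b%:E.
    rewrite -Bb; apply: le_trans (nneseries_lim_ge i.+1 _) => //.
    by rewrite big_nat_recr//= leeDr// sume_ge0.
  rewrite /a -EFinM lee_fin => ai.
  rewrite ler_pdivlMr ?p2//.
  have : ((rnorm (u i.+1 t - u i t) * 2 ^+ i) ^+ 2 <= (b + 1) ^+ 2)%R.
    have e4 : ((2 ^+ i) ^+ 2 = 4 ^+ i :> R)%R
      by rewrite -exprM mulnC exprM -natrX.
    rewrite exprMn e4 mulrC; apply: le_trans ai _; nra.
  by rewrite ler_sqr ?nnegrE ?mulr_ge0 ?rnorm_ge0 ?(ltW (p2 _))// addr_ge0.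
pose w t := match pselect (G t) with
  | left tG => sval (cid (cauchy t tG)) | right _ => 0%R end.
have wP t : G t -> (rnorm (w t - u n t))%R @[n --> \oo] --> (0 : R)%R.
  by rewrite /w; case: pselect => // tG _; case: cid.
have w0 t : ~ G t -> w t = 0%R by rewrite /w; case: pselect.
have wm : weakly_measurable w.
  move=> y; split.
    apply: (@measurable_fun_cvg _ _ _ _
        (fun n t => \1_G t * Re (inner (u n t) y))%R).
      move=> n; apply: measurable_funM; last exact: (um n y).1.
      exact: measurable_indic.
    move=> t _; have [tG|tG] := pselect (G t).
      under eq_fun do rewrite indicE mem_set// mul1r.
      by apply: cvg_Re_inner; exact: wP.
    under eq_fun do rewrite indicE memNset// mul0r.
    by rewrite w0// inner0l; exact: cvg_cst.
  apply: (@measurable_fun_cvg _ _ _ _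
      (fun n t => \1_G t * Im (inner (u n t) y))%R).
    move=> n; apply: measurable_funM; last exact: (um n y).2.
    exact: measurable_indic.
  move=> t _; have [tG|tG] := pselect (G t).
    under eq_fun do rewrite indicE mem_set// mul1r.
    by apply: cvg_Im_inner; exact: wP.
  under eq_fun do rewrite indicE memNset// mul0r.
  by rewrite w0// inner0l; exact: cvg_cst.
exists w => // k.
rewrite (@ge0_negligible_integral _ _ _ mu setT (~` G))//; last 3 first.
- exact: measurableC.
- by apply/measurable_EFinP; apply: measurable_sqr_rnorm => //;
    exact: weakly_measurableB.
- by move=> t _; rewrite lee_fin sqr_ge0.
rewrite setTD setCK.
rewrite (eq_integral
    (fun t => limn_einf (fun j => (rnorm (u j t - u k t) ^+ 2)%:E))); last first.
  move=> t /set_mem tG; apply/esym/limn_einf_cvg.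
  by apply: cvg_EFin; [exact: nearW|exact: cvg_sqr_rnormD (wP t tG)].
apply: le_trans (fatou mu mG _ _) _.
- by move=> j; exact: measurable_funTS.
- by move=> j t _; rewrite lee_fin sqr_ge0.
apply: (@limn_einf_le_near _ _ k) => j kj.
apply: le_trans (uc k j kj); apply: ge0_subset_integral => //.
by move=> t _; rewrite lee_fin sqr_ge0.
Qed.

End l2_completeness.

(** * Linear selections of linear relations *)

Section linear_selection.
Context (K : fieldType) (X Y : lmodType K).
Implicit Types (Rel G : set (X * Y)).

Definition linear_closed G := forall (a : K) p q, G p -> G q -> G (a *: p + q).

Definition single_valued G := forall x y y', G (x, y) -> G (x, y') -> y = y'.

(** A maximal single-valued linear part of the relation, given by Zorn's lemma,
    is defined everywhere: a pair (x, y) of the relation with x outside its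
    domain could be added to it. *)
Lemma linear_selection Rel : linear_closed Rel -> Rel 0 ->
  (forall x, exists y, Rel (x, y)) ->
  exists f : X -> Y, (forall a x y, f (a *: x + y) = a *: f x + f y) /\
    forall x, Rel (x, f x).
Proof.
move=> linR R0 totR.
pose P G := [/\ linear_closed G, single_valued G & G `<=` Rel].
have [G [[linG funG GR] Gmax]] : exists G, P G /\ forall G', G `<` G' -> ~ P G'.
  apply: Zorn_bigcup => F FP chainF; split.
  - move=> a p q [G1 F1 G1p] [G2 F2 G2q].
    have [G12|G21] := chainF _ _ F1 F2.
      by exists G2 => //; have [lin _ _] := FP _ F2; apply: lin => //; exact: G12.
    by exists G1 => //; have [lin _ _] := FP _ F1; apply: lin => //; exact: G21.
  - move=> x y y' [G1 F1 G1p] [G2 F2 G2q].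
    have [G12|G21] := chainF _ _ F1 F2.
      by have [_ sv _] := FP _ F2; apply: sv G2q; exact: G12.
    by have [_ sv _] := FP _ F1; apply: sv (G21 _ G2q).
  - by move=> p [G1 F1 G1p]; have [_ _] := FP _ F1; exact.
have G0 : G 0.
  have [[p Gp]|Gn] := pselect (exists p, G p).
    by have := linG (-1) _ _ Gp Gp; rewrite scaleN1r addNr.
  exfalso; apply: (Gmax [set 0]).
    split => [p Gp|/(_ 0 erefl) ?]; first by exfalso; apply: Gn; exists p.
    by apply: Gn; exists 0.
  split; last by move=> _ ->.
    by move=> a _ _ -> ->; rewrite scaler0 addr0.
  by move=> x y y' [_ ->] [_ ->].
have GN p : G p -> G (- p).
  by move=> Gp; have := linG (-1) _ _ Gp G0; rewrite scaleN1r addr0.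
have Gdom x : exists y, G (x, y).
  apply: contrapT => /forallNP Gx.
  have [y xy] := totR x.
  pose G' := [set q | exists c p, G p /\ q = c *: (x, y) + p].
  apply: (Gmax G').
    split; first by move=> p Gp; exists 0, p; rewrite scale0r add0r.
    move=> G'G; apply: (Gx y); apply: G'G.
    by exists 1, 0; rewrite scale1r addr0.
  split.
  - move=> a _ _ [c [p [Gp ->]]] [e [q [Gq ->]]].
    exists (a * c + e), (a *: p + q); split; first exact: linG.
    by rewrite scalerDr scalerA scalerDl addrACA.
  - move=> x1 y1 y2 [c [[p1 p2] [Gp [-> ->]]]] [e [[q1 q2] [Gq []]]] /= E ->.
    have [ce|ce] := eqVneq c e.
      rewrite -ce; congr (_ + _); move: E; rewrite -ce => /addrI pq.
      by apply: funG Gp _; rewrite pq.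
    exfalso; apply: (Gx ((e - c)^-1 *: (p2 - q2))).
    have xE : x = (e - c)^-1 *: (p1 - q1).
      have -> : p1 - q1 = (e - c) *: x.
        by rewrite -(addKr (c *: x) p1) E addrA addrK scalerBl addrC.
      by rewrite scalerA mulVf ?scale1r// subr_eq0 eq_sym.
    have := linG (e - c)^-1 _ _ (linG 1 _ _ Gp (GN _ Gq)) G0.
    by rewrite addr0 scale1r xE.
  - move=> _ [c [p [Gp ->]]]; apply: linR => //; exact: GR.
have [f fG] := choice Gdom.
exists f; split; last by move=> x; exact: GR.
move=> a x y; apply: funG (fG _) _.
exact: (linG a _ _ (fG x) (fG y)).
Qed.

End linear_selection.

(** * Vector fields with a prescribed Gram kernel *)

Section linear_combination_theory.
Context (R : realType) (H : hilbertType R).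
Implicit Types (e : nat -> H) (s : seq (R[i] * nat)).

Definition scale_terms (a : R[i]) s := [seq (a * b.1, b.2) | b <- s].

Lemma lincomb_cat e s1 s2 :
  lincomb e (s1 ++ s2) = lincomb e s1 + lincomb e s2.
Proof. by rewrite /lincomb big_cat. Qed.

Lemma lincomb_scale e a s : lincomb e (scale_terms a s) = a *: lincomb e s.
Proof.
rewrite /lincomb big_map scaler_sumr; apply: eq_bigr => b _.
by rewrite scalerA.
Qed.

Lemma lincomb_sub e s1 s2 :
  lincomb e (s1 ++ scale_terms (- 1) s2) = lincomb e s1 - lincomb e s2.
Proof. by rewrite lincomb_cat lincomb_scale scaleN1r. Qed.

Lemma inner_lincomb e s :
  inner (lincomb e s) (lincomb e s) =
  kernel_form (fun i j => inner (e i) (e j)) s s.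
Proof.
rewrite /lincomb inner_suml; apply: eq_bigr => a _.
rewrite inner_sumr; apply: eq_bigr => b _.
by rewrite innerZl innerZr mulrA.
Qed.

(** The vectors are orthonormal except that some may be 0; this covers finite
    and infinite dimension at once. *)
Lemma orthonormal_span_dense : separable_space H ->
  exists e : nat -> H,
  [/\ forall i j, i != j -> inner (e i) (e j) = 0,
      forall i, inner (e i) (e i) = (e i != 0)%:R
    & forall x (r : R), 0 < r -> exists s, rnorm (x - lincomb e s) < r].
Proof.
move=> /separable_dense_seq[z zP]; exists (gram_schmidt z); split.
- exact: gram_schmidt_orthogonal.
- exact: gram_schmidt_sqr.
- move=> x r /(zP x)[n xz]; have [c zE] := gram_schmidt_span z n.
  exists [seq (c i, nat_of_ord i) | i : 'I_n.+1 <- enum 'I_n.+1].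
  by rewrite /lincomb big_map big_enum -zE.
Qed.

End linear_combination_theory.

Section kernel_fields.
Context d (Omega : measurableType d) (R : realType) (H : hilbertType R).
Context (e : nat -> H) (h : nat -> nat -> Omega -> R[i]).
Context (e_orth : forall i j, i != j -> inner (e i) (e j) = 0).
Context (e_sqr : forall i, inner (e i) (e i) = (e i != 0)%:R).
Context (h_psd : forall t, psd_kernel (fun i j => h i j t)).
Context (h_null : forall i t, e i = 0 -> h i i t = 0).
Context (h_meas : forall i j, cmeasurable (h i j)).

Let g t i j := h i j t.

(** The rows of the Cholesky factor, as combinations of the e k. *)
Definition kernel_field i t : H :=
  \sum_(k < i.+1) cholesky (fun i j => h i j t) i k *: e k.

(** The rows are lower triangular, so two of them can be written with the same
    range of summation. *)
Lemma kernel_field_widen n i t : (i < n)%N ->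
  kernel_field i t = \sum_(k < n) cholesky (g t) i k *: e k.
Proof.
move=> ltin; rewrite /kernel_field.
rewrite (big_ord_widen n (fun k => cholesky (g t) i k *: e k))//.
rewrite [RHS](bigID (fun k : 'I_n => (k < i.+1)%N)) /=.
rewrite [X in _ = _ + X]big1 ?addr0// => k; rewrite -leqNgt => ik.
by rewrite cholesky_lower ?scale0r//; exact: h_psd.
Qed.

Lemma inner_kernel_field i j t :
  inner (kernel_field i t) (kernel_field j t) = h i j t.
Proof.
pose n := (maxn i j).+1.
have ltin : (i < n)%N by rewrite ltnS leq_maxl.
have ltjn : (j < n)%N by rewrite ltnS leq_maxr.
rewrite (kernel_field_widen _ ltin) (kernel_field_widen _ ltjn).
rewrite -(choleskyE j (h_psd t) ltin) inner_suml; apply: eq_bigr => k _.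
rewrite inner_sumr (bigD1 k)//= big1 ?addr0 => [|l lk]; last first.
  by rewrite innerZl innerZr e_orth ?mulr0// eq_sym.
rewrite innerZl innerZr e_sqr; have [ek|_] := eqVneq (e k) 0;
  last by rewrite mulr1.
by rewrite (cholesky_null i (h_psd t) (h_null t ek)) !mul0r.
Qed.

(** The pivots are nonnegative reals, so the inverse of a pivot is the square of
    the inverse of its square root, a measurable function of t. *)
Lemma schur_iter_measurable n i j :
  cmeasurable (fun t => schur_iter (g t) n i j).
Proof.
elim: n i j => [|n IHn] i j /=; first exact: h_meas.
rewrite /schur; apply: cmeasurableD => //; apply: cmeasurableN.
apply: cmeasurableM; first exact: cmeasurableM.
rewrite (_ : (fun t => _) = (fun t => let r :=
    ((Num.sqrt (Re (schur_iter (g t) n n n)))^-1)%:C in r * r)).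
  have gm : cmeasurable (fun t =>
      ((Num.sqrt (Re (schur_iter (g t) n n n)))^-1)%:C).
    apply: cmeasurable_real; apply: measurable_inv_sqrt => [t|].
      have := psd_diag_ge0 n (schur_iter_psd n (h_psd t)).
      by rewrite ge0_complexE => /andP[].
    exact: (IHn n n).1.
  exact: (cmeasurableM gm gm).
apply/funext => t /=.
have := psd_diag_ge0 n (schur_iter_psd n (h_psd t)).
rewrite -/(g t) => g0; rewrite {1}(ge0_complex g0) -fmorphV -rmorphM /=.
rewrite -expr2 exprVn sqr_sqrtr//.
by move: g0; rewrite ge0_complexE => /andP[].
Qed.

Lemma cholesky_measurable i k : cmeasurable (fun t => cholesky (g t) i k).
Proof.
apply: cmeasurableM; first exact: schur_iter_measurable.
apply: cmeasurable_real; apply: measurable_inv_sqrt => [t|].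
  have := psd_diag_ge0 k (schur_iter_psd k (h_psd t)).
  by rewrite ge0_complexE => /andP[].
exact: (schur_iter_measurable k k k).1.
Qed.

Lemma kernel_field_measurable i : weakly_measurable (kernel_field i).
Proof.
apply: weakly_measurable_sum => k; apply: weakly_measurableZ.
  exact: cholesky_measurable.
exact: weakly_measurable_cst.
Qed.

Lemma lincomb_field_measurable s :
  weakly_measurable (fun t => lincomb (kernel_field ^~ t) s).
Proof.
apply: weakly_measurable_sum => a; apply: weakly_measurableZ.
  exact: cmeasurable_cst.
exact: kernel_field_measurable.
Qed.

End kernel_fields.

(** The Cholesky fields of the density kernel satisfy the frame identity on the
    finite combinations of a sequence with dense span. *)
Lemma povm_fields d (Omega : measurableType d) (R : realType)
    (H : hilbertType R) (M : set Omega -> {linear H -> H}) :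
  separable_space H -> is_povm M ->
  exists (mu : {finite_measure set Omega -> \bar R}) (e : nat -> H)
      (v : nat -> Omega -> H),
  [/\ forall x (r : R), 0 < r -> exists s, rnorm (x - lincomb e s) < r,
      forall s, weakly_measurable (fun t => lincomb (v ^~ t) s)
    & forall s E, measurable E ->
        (\int[mu]_(t in E) (rnorm (lincomb (v ^~ t) s) ^+ 2)%:E =
          (Re (inner (M E (lincomb e s)) (lincomb e s)))%:E)%E].
Proof.
move=> sH povmM; have [e [e_orth e_sqr e_dense]] := orthonormal_span_dense sH.
have [mu [h [h_psd h_null h_dens]]] := povm_kernel povmM e.
have h_meas i j : cmeasurable (h i j) by have [] := h_dens i j.
exists mu, e, (kernel_field e h); split => //.
  by move=> s; exact: lincomb_field_measurable.
move=> s E mE.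
have [_ [ri _] /(_ E mE) fE] : is_cdensity mu
    (fun t => kernel_form (fun i j => h i j t) s s)
    (fun E => kernel_form (fun i j => inner (M E (e i)) (e j)) s s).
  apply: is_cdensity_sum => a; apply: is_cdensity_sum => b.
  exact: is_cdensityZ.
rewrite povm_form_lincomb -fE /cintegral /= /Rintegral fineK; last first.
  by apply: integrable_fin_num => //; exact: integrable_setTS.
apply: eq_integral => t _; congr _%:E; rewrite rnorm_sqr inner_lincomb.
congr Re; apply: eq_bigr => a _; apply: eq_bigr => b _; congr (_ * _).
exact: inner_kernel_field.
Qed.

(** * Quadratic forms of positive operators *)

Section quadratic_forms.
Context (R : realType) (H : hilbertType R).
Implicit Types (x y : H) (S : {linear H -> H}).

Let linD S x y : S (x + y) = S x + S y. Proof. exact: linearD. Qed.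
Let linN S x : S (- x) = - S x. Proof. exact: linearN. Qed.
Let linZ S a x : S (a *: x) = a *: S x. Proof. exact: linearZ. Qed.

Lemma form_ge0 S x : positive_operator S -> 0 <= Re (inner (S x) x).
Proof. by move=> /(_ x); rewrite ge0_complexE => /andP[]. Qed.

(** The form is real at x + y and at x + i y. *)
Lemma form_hermitian S x y : positive_operator S ->
  inner (S y) x = (inner (S x) y)^*%C.
Proof.
move=> S0; have im0 z : Im (inner (S z) z) = 0 by exact: ger0_Im (S0 z).
have := im0 (x + y); have := im0 (x + 'i%C *: y).
rewrite !linD !linZ !(innerDl, innerDr, innerZl, innerZr).
rewrite !(ReD, ImD, ReM, ImM, ReJ, ImJ) /= !im0 => h1 h2.
by apply: complexP; rewrite ?ReJ ?ImJ; lra.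
Qed.

(** Expand the nonnegative value of the form at r x - y and divide by r. *)
Lemma form_add_le S (r : R) x y : positive_operator S -> 0 < r ->
  Re (inner (S (x + y)) (x + y)) <=
  (1 + r) * Re (inner (S x) x) + (1 + r^-1) * Re (inner (S y) y).
Proof.
move=> S0 r0; have := form_ge0 (r%:C *: x - y) S0.
rewrite !linD !linN !linZ.
rewrite !(innerDl, innerDr, innerNl, innerNr, innerZl, innerZr).
rewrite !(ReD, ReN, ReM, ImM, ReJ, ImJ) /=.
set a := Re (inner (S x) x); set b := Re (inner (S y) y).
set c := Re (inner (S x) y); set f := Re (inner (S y) x) => h.
have {}h : 0 <= r * (r * a) - r * c - r * f + b by lra.
have -> : (1 + r) * a + (1 + r^-1) * b =
    a + b + r^-1 * (r * (r * a) + b).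
  by field; rewrite gt_eqF.
have : r^-1 * (r * (c + f)) <= r^-1 * (r * (r * a) + b).
  by rewrite ler_pM2l ?invr_gt0//; lra.
rewrite mulKf ?gt_eqF//; lra.
Qed.

Lemma sqr_rnorm_add_le (r : R) x y : 0 < r ->
  rnorm (x + y) ^+ 2 <= (1 + r) * rnorm x ^+ 2 + (1 + r^-1) * rnorm y ^+ 2.
Proof.
move=> r0; rewrite !rnorm_sqr.
by apply: (@form_add_le (idfun : {linear H -> H})).
Qed.

Lemma sqr_rnorm_add_le2 x y :
  rnorm (x + y) ^+ 2 <= 2 * rnorm x ^+ 2 + 2 * rnorm y ^+ 2.
Proof. by have := parallelogram x y; have := sqr_ge0 (rnorm (x - y)); lra. Qed.

Lemma form_bounded S : bounded_operator S ->
  exists2 C : R, 1 <= C & forall x, Re (inner (S x) x) <= C * rnorm x ^+ 2.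
Proof.
move=> [C0 SC]; have C0' := normr_ge0 C0.
exists ((`|C0| + 1) ^+ 2) => [|x]; first by nra.
have : rnorm (S x) <= `|C0| * rnorm x.
  by apply: le_trans (SC x) _; rewrite ler_wpM2r ?rnorm_ge0// ler_norm.
rewrite Re_inner_polar => Sx.
have := sqr_ge0 (rnorm (S x - x)); have := rnormD (S x) x.
have := rnorm_ge0 (S x + x); have := rnorm_ge0 x => x0 y0 xy sq.
have : rnorm (S x + x) ^+ 2 <= ((`|C0| + 1) * rnorm x) ^+ 2.
  by rewrite ler_sqr ?nnegrE ?mulr_ge0 ?addr_ge0//; nra.
have := sqr_ge0 ((`|C0| + 1) * rnorm x); lra.
Qed.

(** By positivity at C x - S x, where C bounds the form, |S x|^2 is at most
    C <S x, x>; and |x| is at most a constant times |S x|, because S has a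
    bounded inverse. *)
Lemma form_coercive S : positive_operator S -> bounded_operator S ->
  invertible_operator S ->
  exists2 A : R, 0 < A & forall x, A * rnorm x ^+ 2 <= Re (inner (S x) x).
Proof.
move=> S0 /form_bounded[C C1 SC] [T [[B TB] ST _]].
have C0 : 0 < C by lra.
exists (((B ^+ 2 + 1) * C)^-1).
  by rewrite invr_gt0 mulr_gt0// ltr_pwDr// sqr_ge0.
move=> x; rewrite mulrC ler_pdivrMr; last first.
  by rewrite mulr_gt0// ltr_pwDr// sqr_ge0.
have Sx : rnorm (S x) ^+ 2 <= C * Re (inner (S x) x).
  have := form_ge0 (C%:C *: x - S x) S0.
  have := SC (S x).
  rewrite !linD !linN !linZ.
  rewrite !(innerDl, innerDr, innerNl, innerNr, innerZl, innerZr).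
  rewrite !(ReD, ReN, ReM, ImM, ReJ, ImJ) /=.
  have herm : Re (inner (S (S x)) x) = rnorm (S x) ^+ 2.
    by rewrite (form_hermitian x (S x) S0) ReJ -rnorm_sqr.
  rewrite herm -rnorm_sqr.
  set a := Re (inner (S x) x); set b := rnorm (S x) ^+ 2.
  set c := Re (inner (S (S x)) (S x)) => h1 h2.
  have : 0 <= C * (C * a) - 2 * C * b + C * b by lra.
  have -> : C * (C * a) - 2 * C * b + C * b = C * (C * a - b) by ring.
  by rewrite pmulr_rge0// subr_ge0.
have : rnorm x <= `|B| * rnorm (S x).
  rewrite -{1}[x]ST; apply: le_trans (TB _) _.
  by rewrite ler_wpM2r ?rnorm_ge0// ler_norm.
have := rnorm_ge0 x; have := rnorm_ge0 (S x) => s0 x0 xS.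
have xS2 : rnorm x ^+ 2 <= B ^+ 2 * rnorm (S x) ^+ 2.
  rewrite -[B ^+ 2]real_normK ?num_real// -exprMn.
  by rewrite ler_sqr ?nnegrE ?mulr_ge0.
have := form_ge0 x S0; have := sqr_ge0 B; nra.
Qed.

End quadratic_forms.

(** * Continuous extension to the whole space *)

Section extension.
Context d (Omega : measurableType d) (R : realType) (H : hilbertType R).
Context (mu : {measure set Omega -> \bar R}).
Context (M : set Omega -> {linear H -> H}).
Context (e : nat -> H) (v : nat -> Omega -> H).
Context (sepH : separable_space H) (povmM : is_povm M).
Context (e_dense : forall x (r : R), 0 < r ->
  exists s, rnorm (x - lincomb e s) < r).
Context (v_meas : forall s, weakly_measurable (fun t => lincomb (v ^~ t) s)).
Context (v_quad : forall s E, measurable E ->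
  (\int[mu]_(t in E) (rnorm (lincomb (v ^~ t) s) ^+ 2)%:E =
    (Re (inner (M E (lincomb e s)) (lincomb e s)))%:E)%E).

Let V s t : H := lincomb (v ^~ t) s.
Let sqint E (u : Omega -> H) : \bar R :=
  (\int[mu]_(t in E) (rnorm (u t) ^+ 2)%:E)%E.

Lemma sqint_le E (a b : R) (u1 u2 u3 : Omega -> H) : measurable E ->
  0 <= a -> 0 <= b ->
  weakly_measurable u1 -> weakly_measurable u2 -> weakly_measurable u3 ->
  (forall t,
    rnorm (u3 t) ^+ 2 <= a * rnorm (u1 t) ^+ 2 + b * rnorm (u2 t) ^+ 2) ->
  (sqint E u3 <= a%:E * sqint E u1 + b%:E * sqint E u2)%E.
Proof.
move=> mE a0 b0 m1 m2 m3 u123.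
have mf (u : Omega -> H) : weakly_measurable u ->
    measurable_fun E (fun t => (rnorm (u t) ^+ 2)%:E).
  move=> um; apply/measurable_EFinP.
  by apply: measurable_funTS; exact: measurable_sqr_rnorm.
have f0 (u : Omega -> H) t : (0 <= (rnorm (u t) ^+ 2)%:E)%E.
  by rewrite lee_fin sqr_ge0.
rewrite /sqint -!ge0_integralZl_EFin//; [|exact: mf..].
rewrite -ge0_integralD//.
- apply: ge0_le_integral => //; first exact: mf.
    apply: emeasurable_funD; exact: emeasurable_funM (measurable_cst _) (mf _ _).
  by move=> t _; rewrite -!EFinM -EFinD lee_fin.
- by move=> t _; rewrite -EFinM lee_fin mulr_ge0// sqr_ge0.
- exact: emeasurable_funM (measurable_cst _) (mf _ m1).
- by move=> t _; rewrite -EFinM lee_fin mulr_ge0// sqr_ge0.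
- exact: emeasurable_funM (measurable_cst _) (mf _ m2).
Qed.

(** The graph, up to null sets, of the continuous extension of the map sending a
    combination of the e i to the same combination of the fields v i. *)
Definition extension_rel : set (H * (Omega -> H)) := [set p |
  weakly_measurable p.2 /\ forall r : R, 0 < r -> exists s,
    rnorm (p.1 - lincomb e s) ^+ 2 <= r /\
    (sqint setT (fun t => p.2 t - V s t)%R <= r%:E)%E].

Lemma extension_rel0 : extension_rel 0.
Proof.
split; first exact: weakly_measurable_cst.
move=> r r0; exists [::]; rewrite /V /lincomb big_nil /= subrr rnorm0 expr0n /=.
split; first exact: ltW.
rewrite /sqint (eq_integral (cst 0%E)) ?integral0 ?lee_fin ?ltW// => t _.
by rewrite big_nil subrr rnorm0 expr0n.
Qed.

(** The error of a combination is at most k times the first error plus twice the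
    second one, whence the tolerance r / (k + 2). *)
Lemma extension_rel_linear : linear_closed extension_rel.
Proof.
move=> a [x u] [y w] [/= um xu] [/= wm yw]; split => /=.
  exact: weakly_measurable_linear.
move=> r r0; pose k := 2 * Re `|a| ^+ 2.
have k0 : 0 <= k by rewrite mulr_ge0 ?sqr_ge0.
have k2 : 0 < k + 2 by rewrite ltr_wpDl.
have r'0 : 0 < r / (k + 2) by rewrite divr_gt0.
have [s [xs us]] := xu _ r'0; have [s' [ys ws]] := yw _ r'0.
have sumr : k * (r / (k + 2)) + 2 * (r / (k + 2)) = r.
  by field; rewrite gt_eqF.
have dist (x1 x2 y1 y2 : H) : rnorm (a *: x1 + y1 - (a *: x2 + y2)) ^+ 2 <=
    k * rnorm (x1 - x2) ^+ 2 + 2 * rnorm (y1 - y2) ^+ 2.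
  rewrite opprD addrACA -scalerBr; apply: le_trans (sqr_rnorm_add_le2 _ _) _.
  by rewrite rnormZ exprMn mulrA.
exists (scale_terms a s ++ s'); split.
  rewrite lincomb_cat lincomb_scale; apply: le_trans (dist _ _ _ _) _.
  by rewrite -sumr lerD// ler_wpM2l.
have VE t : V (scale_terms a s ++ s') t = a *: V s t + V s' t.
  by rewrite /V lincomb_cat lincomb_scale.
apply: le_trans (@sqint_le setT k 2 (fun t => u t - V s t)
  (fun t => w t - V s' t) _ measurableT k0 _ _ _ _ _) _ => //.
- by apply: weakly_measurableB => //; exact: v_meas.
- by apply: weakly_measurableB => //; exact: v_meas.
- apply: weakly_measurableB => //; last exact: v_meas.
  exact: weakly_measurable_linear.
- by move=> t; rewrite VE; exact: dist.
- have -> : (r%:E = k%:E * (r / (k + 2))%:E + 2%:E * (r / (k + 2))%:E)%E.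
    by rewrite -!EFinM -EFinD sumr.
  apply: leeD.
    by apply: lee_wpmul2l => //; rewrite lee_fin.
  by apply: lee_wpmul2l.
Qed.

(** Approximate x by combinations so fast that their fields satisfy the Cauchy
    condition of completeness. As the form of M on the whole space is at most C
    times the square of the norm, squared errors c k / (4 C) on x give
    squared errors c k on the fields. *)
Lemma extension_rel_total x : exists u, extension_rel (x, u).
Proof.
have [M0 _ _] := povmM.
have [/form_bounded[C C1 MC] _] := M0 setT measurableT.
have C0 : 0 < C by lra.
pose c k : R := (4 ^+ k)^-1 / (2 ^ k.+1)%:R.
have c0 k : 0 < c k.
  by rewrite /c divr_gt0 ?invr_gt0 ?exprn_gt0 ?ltr0n ?expn_gt0.
have c_le k j : (k <= j)%N -> c j <= c k.
  move=> kj; rewrite /c ler_pM ?invr_ge0 ?exprn_ge0 ?ler0n//.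
    by rewrite lef_pV2 ?posrE ?exprn_gt0// ler_weXn2l// ler1n.
  by rewrite lef_pV2 ?posrE ?ltr0n ?expn_gt0// ler_nat leq_exp2l.
have approx k : exists s, rnorm (x - lincomb e s) ^+ 2 <= c k / (4 * C).
  have q0 : 0 < c k / (4 * C) by rewrite divr_gt0// mulr_gt0.
  have [|s xs] := @e_dense x (Num.sqrt (c k / (4 * C))).
    by rewrite sqrtr_gt0.
  exists s; rewrite -(sqr_sqrtr (ltW q0)) ler_sqr ?nnegrE ?rnorm_ge0 ?sqrtr_ge0//.
  exact: ltW.
have [s sP] := choice approx.
have [|||w wm wP] := @l2_complete _ _ _ _ mu (fun k => V (s k)) => //.
- by move=> k; exact: v_meas.
- move=> k j kj.
  rewrite (eq_integral (fun t =>
      (rnorm (lincomb (v ^~ t) (s j ++ scale_terms (- 1) (s k))) ^+ 2)%:E));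
    last by move=> t _; rewrite lincomb_sub.
  rewrite v_quad// lee_fin -/(c k) lincomb_sub.
  apply: le_trans (MC _) _.
  have -> : lincomb e (s j) - lincomb e (s k) =
      (x - lincomb e (s k)) + (- (x - lincomb e (s j))).
    by rewrite opprB [RHS]addrC addrA subrK.
  apply: (@le_trans _ _ (C * (2 * (c k / (4 * C)) + 2 * (c k / (4 * C))))).
    rewrite ler_wpM2l ?(ltW C0)//.
    apply: le_trans (sqr_rnorm_add_le2 _ _) _; rewrite rnormN lerD//.
      by rewrite ler_pM2l// sP.
    rewrite ler_pM2l// (le_trans (sP j))// ler_pM2r ?c_le//.
    by rewrite invr_gt0 mulr_gt0.
  rewrite le_eqVlt; apply/orP; left; apply/eqP; field.
  by rewrite gt_eqF.
exists w; split => //= r r0.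
have [k ck] : exists k, c k <= r.
  have [k kr] : exists k, k.+1%:R^-1 < r.
    exists (Num.truncn r^-1).
    by rewrite -ltf_pV2 ?posrE ?invr_gt0// invrK Num.Theory.truncnS_gt.
  exists k; apply: le_trans (ltW kr); rewrite /c.
  have h1 : (4 ^+ k)^-1 <= 1 :> R.
    by rewrite invf_le1 ?exprn_gt0// exprn_ege1// ler1n.
  have h2 : ((2 ^ k.+1)%:R)^-1 <= k.+1%:R^-1 :> R.
    by rewrite lef_pV2 ?posrE ?ltr0n ?expn_gt0// ler_nat ltnW// ltn_expl.
  have i1 : 0 <= (4 ^+ k)^-1 :> R by rewrite invr_ge0 exprn_ge0.
  have i2 : 0 <= ((2 ^ k.+1)%:R)^-1 :> R by rewrite invr_ge0 ler0n.
  by have := ler_pM i1 i2 h1 h2; rewrite mul1r.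
exists (s k); split; last first.
  by apply: le_trans (wP k) _; rewrite lee_fin.
apply: le_trans (sP k) (le_trans _ ck).
rewrite ler_pdivrMr ?mulr_gt0// ler_peMr ?ltW//; lra.
Qed.

Lemma ler_of_linear_error (a b k : R) :
  (forall r, 0 < r -> r <= 1 -> a <= b + r * k) -> a <= b.
Proof.
move=> abk; apply/ler_addgt0Pr => r r0.
pose q := Num.min 1 (r / (`|k| + 1)).
have k1 : 0 < `|k| + 1 by rewrite ltr_wpDl.
have q0 : 0 < q by rewrite lt_min ltr01 divr_gt0.
have q1 : q <= 1 by rewrite ge_min lexx.
have qr : q * (`|k| + 1) <= r.
  by rewrite -ler_pdivlMr// ge_min lexx orbT.
have := abk q q0 q1; have : q * k <= q * `|k| by rewrite ler_pM2l// ler_norm.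
lra.
Qed.

Let error_bound (q c c' r : R) :
  0 <= q -> 0 <= c -> 0 <= c' -> 0 < r -> r <= 1 ->
  (1 + r) * ((1 + r) * q + c * (r ^+ 2 + r)) + c' * (r ^+ 2 + r) <=
  q + r * (3 * q + 4 * c + 2 * c').
Proof.
move=> q0 c0 c'0 r0 r1; have r2 : r ^+ 2 <= r by nra.
have r3 : r ^+ 3 <= r by rewrite exprS; nra.
have e1 : r ^+ 2 * q <= r * q by rewrite ler_wpM2r.
have e2 : c * r ^+ 2 <= c * r by rewrite ler_wpM2l.
have e3 : c * r ^+ 3 <= c * r by rewrite ler_wpM2l.
have e4 : c' * r ^+ 2 <= c' * r by rewrite ler_wpM2l.
lra.
Qed.

(** The identity holds for the finite combinations. Both sides are squares of
    seminorms, so at the cost of factors 1 + r and 1 + 1 / r they can be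
    compared with their values at a combination approximating (x, u) to within
    r^2. The resulting error is linear in r. *)
Lemma extension_rel_quad x u E : extension_rel (x, u) -> measurable E ->
  sqint E u = (Re (inner (M E x) x))%:E.
Proof.
move=> [/= um xu] mE; have [M0 _ _] := povmM.
have [/form_bounded[C C1 MC] ME0] := M0 E mE.
set q := fun z => Re (inner (M E z) z).
have q0 z : 0 <= q z by exact: form_ge0.
have sq0 w : (0 <= sqint E w)%E.
  by apply: integral_ge0 => t _; rewrite lee_fin sqr_ge0.
have approx r : 0 < r -> exists s,
    [/\ q (x - lincomb e s) <= C * r ^+ 2,
        (sqint E (fun t => u t - V s t)%R <= (r ^+ 2)%:E)%E
      & sqint E (V s) = (q (lincomb e s))%:E].
  move=> r0; have [|s [xs us]] := xu (r ^+ 2); first by rewrite exprn_gt0.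
  exists s; split; last exact: v_quad.
    by apply: le_trans (MC _) _; rewrite ler_wpM2l//; lra.
  apply: le_trans us; apply: ge0_subset_integral => //.
    apply/measurable_EFinP; apply: measurable_sqr_rnorm => //.
    by apply: weakly_measurableB => //; exact: v_meas.
  by move=> t _; rewrite lee_fin sqr_ge0.
have upper r : 0 < r -> r <= 1 ->
    (sqint E u <= (q x + r * (3 * q x + 4 * C + 2))%:E)%E.
  move=> r0 r1; have [s [xs us sE]] := approx r r0.
  have r'0 : 0 < r^-1 by rewrite invr_gt0.
  have h1 : q (lincomb e s) <= (1 + r) * q x + (1 + r^-1) * (C * r ^+ 2).
    have -> : lincomb e s = x + (- (x - lincomb e s)) by rewrite opprB subrKC.
    apply: le_trans (form_add_le _ _ ME0 r0) _; rewrite lerD// ler_wpM2l//.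
      lra.
    apply: le_trans xs; rewrite le_eqVlt; apply/orP; left; apply/eqP.
    by rewrite /q (linearN (M E)) innerNl innerNr opprK.
  apply: le_trans (@sqint_le E (1 + r) (1 + r^-1) (V s)
    (fun t => u t - V s t) u mE _ _ _ _ _ _) _ => //.
  - lra.
  - lra.
  - exact: v_meas.
  - by apply: weakly_measurableB => //; exact: v_meas.
  - move=> t; rewrite -{1}[u t](subrKC (V s t)).
    exact: sqr_rnorm_add_le.
  - apply: (@le_trans _ _ ((1 + r) * ((1 + r) * q x + (1 + r^-1) * (C * r ^+ 2))
        + (1 + r^-1) * r ^+ 2)%:E).
      rewrite [leRHS]EFinD (EFinM (1 + r)) (EFinM (1 + r^-1)).
      apply: leeD; apply: lee_wpmul2l => //.
      + by rewrite lee_fin; lra.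
      + by rewrite sE lee_fin.
      + by rewrite lee_fin; lra.
    have rr : (1 + r^-1) * r ^+ 2 = r ^+ 2 + r by field; rewrite gt_eqF.
    rewrite [(1 + r^-1) * (C * _)]mulrCA rr lee_fin.
    have CC : 0 <= C by lra.
    by have := error_bound (q0 x) CC ler01 r0 r1; lra.
have fin : sqint E u \is a fin_num.
  rewrite ge0_fin_numE//; apply: le_lt_trans (upper 1 ltr01 (lexx _)) _.
  exact: ltry.
have [a aE] : exists a, sqint E u = a%:E.
  by exists (fine (sqint E u)); rewrite fineK.
have a0 : 0 <= a by have := sq0 u; rewrite aE lee_fin.
have lower r : 0 < r -> r <= 1 -> q x <= a + r * (3 * a + 4 + 2 * C).
  move=> r0 r1; have [s [xs us sE]] := approx r r0.
  have r'0 : 0 < r^-1 by rewrite invr_gt0.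
  have h1 : q x <= (1 + r) * q (lincomb e s) + (1 + r^-1) * (C * r ^+ 2).
    rewrite -{1}[x](subrKC (lincomb e s)).
    apply: le_trans (form_add_le _ _ ME0 r0) _; rewrite lerD// ler_wpM2l//.
    lra.
  have h2 : q (lincomb e s) <= (1 + r) * a + (1 + r^-1) * r ^+ 2.
    rewrite -lee_fin -sE.
    apply: le_trans (@sqint_le E (1 + r) (1 + r^-1) u
      (fun t => u t - V s t) (V s) mE _ _ _ _ _ _) _ => //.
    - lra.
    - lra.
    - by apply: weakly_measurableB => //; exact: v_meas.
    - exact: v_meas.
    - move=> t; have := sqr_rnorm_add_le (u t) (- (u t - V s t)) r0.
      by rewrite rnormN opprB subrKC.
    - rewrite aE [leRHS]EFinD (EFinM (1 + r)) (EFinM (1 + r^-1)).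
      apply: leeD => //; apply: lee_wpmul2l => //.
      by rewrite lee_fin; lra.
  have rr : (1 + r^-1) * r ^+ 2 = r ^+ 2 + r by field; rewrite gt_eqF.
  move: h1 h2; rewrite [(1 + r^-1) * (C * _)]mulrCA rr => h1 h2.
  have CC : 0 <= C by lra.
  have r1' : 0 <= 1 + r by lra.
  have := error_bound a0 ler01 CC r0 r1; have := ler_wpM2l r1' h2; lra.
rewrite aE; congr _%:E; apply/eqP; rewrite eq_le; apply/andP; split.
  apply: (@ler_of_linear_error _ _ (3 * q x + 4 * C + 2)) => r r0 r1.
  by have := upper r r0 r1; rewrite aE lee_fin.
exact: (@ler_of_linear_error _ _ (3 * a + 4 + 2 * C)).
Qed.

End extension.

(** * Integration against a measure with a density *)

Section density_integral.
Context d (T : measurableType d) (R : realType).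
Context (nu mu : {measure set T -> \bar R}) (g : T -> R).
Context (nu_g : is_RN_derivative nu mu g).
Local Open Scope ereal_scope.
Import HBNNSimple.

Let gm : measurable_fun setT (EFin \o g).
Proof. by apply/measurable_EFinP; have [] := nu_g. Qed.

Let g0 t : 0 <= (g t)%:E.
Proof. by rewrite lee_fin; have [_ + _] := nu_g. Qed.

(** By linearity, from the indicator functions, for which this is the definition
    of a density. *)
(** By monotone convergence from simple functions. *)
Lemma density_integral_nnsfun (h : {nnsfun T >-> R}) :
  \int[nu]_t (h t)%:E = \int[mu]_t ((h t)%:E * (g t)%:E).
Proof.
have hE t : (h t)%:E = \sum_(y \in range h) (y * \1_(h @^-1` [set y]) t)%:E.
  by rewrite fsumEFin// -fimfunE.
have ind0 y t : 0 <= (y * \1_(h @^-1` [set y]) t)%:E.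
  exact: nnfun_muleindic_ge0.
have mA y : measurable (h @^-1` [set y]) by exact: measurable_funPTI.
have im y : measurable_fun setT (fun t => (\1_(h @^-1` [set y]) t : R)%:E).
  by apply/measurable_EFinP; exact: measurable_indic.
have yim y : measurable_fun setT (fun t => (y * \1_(h @^-1` [set y]) t)%:E).
  by apply/measurable_EFinP; apply: measurable_funM => //;
    exact: measurable_indic.
have hgE t : (h t)%:E * (g t)%:E =
    \sum_(y \in range h) (y * \1_(h @^-1` [set y]) t)%:E * (g t)%:E.
  by rewrite hE ge0_mule_fsuml.
under eq_integral do rewrite hE.
under [RHS]eq_integral do rewrite hgE.
rewrite !ge0_integral_fsum//; last 2 first.
- by move=> y; exact: emeasurable_funM.
- by move=> y t _; exact: mule_ge0.
apply: eq_fsbigr => y /set_mem[t0 _ hy].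
have y0 : (0 <= y)%R by rewrite -hy.
under eq_integral do rewrite EFinM.
under [RHS]eq_integral do rewrite EFinM -muleA.
rewrite !ge0_integralZl_EFin//; last 2 first.
- by move=> t _; rewrite mule_ge0// lee_fin.
- exact: emeasurable_funM.
congr (_ * _); rewrite integral_indic// setIT.
have [_ _ ->//] := nu_g; rewrite integral_mkcond; apply: eq_integral => t _.
by rewrite epatch_indic muleC.
Qed.

Lemma density_integral (q : T -> R) : measurable_fun setT q ->
  (forall t, 0 <= q t)%R ->
  \int[nu]_t (q t)%:E = \int[mu]_t ((q t)%:E * (g t)%:E).
Proof.
move=> qm q0; have qm' : measurable_fun setT (EFin \o q).
  exact/measurable_EFinP.
pose h := nnsfun_approx measurableT qm'.
have hq t : (EFin \o h n) t @[n --> \oo] --> (q t)%:E.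
  by apply: (cvg_nnsfun_approx measurableT qm') => // x _; rewrite lee_fin.
have hnd t : {homo (fun n => h n t) : m n / (m <= n)%N >-> (m <= n)%R}.
  by move=> m n mn; exact/lefP/nd_nnsfun_approx.
have lhs : \int[nu]_t (EFin \o h n) t @[n --> \oo] --> \int[nu]_t (q t)%:E.
  under [X in _ --> X]eq_integral do rewrite -(cvg_lim _ (hq _))//.
  apply: cvg_monotone_convergence => //.
  - by move=> n; exact/measurable_EFinP.
  - by move=> n t _; rewrite lee_fin.
  - by move=> t _ m n mn; rewrite lee_fin; exact: hnd.
have hqg t : ((h n t)%:E * (g t)%:E) @[n --> \oo] --> (q t)%:E * (g t)%:E.
  by apply: cvgeZr => //; exact: hq.
have rhs : \int[mu]_t ((h n t)%:E * (g t)%:E) @[n --> \oo] -->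
    \int[mu]_t ((q t)%:E * (g t)%:E).
  under [X in _ --> X]eq_integral do rewrite -(cvg_lim _ (hqg _))//.
  apply: cvg_monotone_convergence => //.
  - by move=> n; apply: emeasurable_funM => //; exact/measurable_EFinP.
  - by move=> n t _; rewrite mule_ge0// lee_fin.
  - by move=> t _ m n mn; rewrite lee_wpmul2r// lee_fin; exact: hnd.
have lhsE : (fun n => \int[nu]_t (EFin \o h n) t) =
    (fun n => \int[mu]_t ((h n t)%:E * (g t)%:E)).
  by apply/funext => n; exact: density_integral_nnsfun.
by rewrite lhsE in lhs; exact: cvg_unique lhs rhs.
Qed.

End density_integral.

(** * Existence and uniqueness of the operator-valued frame *)

Section existence.
Context d (Omega : measurableType d) (R : realType) (H : hilbertType R).
Context (M : set Omega -> {linear H -> H}).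

(** The extension of the Cholesky fields to H is only determined up to a null
    set for each x; the linear selection picks representatives that depend
    linearly on x at every point. *)
Lemma povm_dilation : separable_space H -> is_povm M ->
  exists (mu : {finite_measure set Omega -> \bar R}) (T : H -> Omega -> H),
  [/\ forall (a : R[i]) x y t, T (a *: x + y) t = a *: T x t + T y t,
      forall x, weakly_measurable (T x)
    & forall x E, measurable E ->
        (\int[mu]_(t in E) (rnorm (T x t) ^+ 2)%:E =
          (Re (inner (M E x) x))%:E)%E].
Proof.
move=> sH povmM; have [mu [e [v [e_dense v_meas v_quad]]]] :=
  povm_fields sH povmM.
have [T [linT TR]] := linear_selection
  (extension_rel_linear sH v_meas) (extension_rel0 mu e v)
  (extension_rel_total sH povmM e_dense v_meas v_quad).
exists mu, T; split.
- by move=> a x y t; rewrite linT.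
- by move=> x; have [] := TR x.
- by move=> x E mE; exact: (extension_rel_quad sH povmM v_meas v_quad (TR x)).
Qed.

Lemma weakly_measurable_family : separable_space H ->
  is_measurable_family (K := fun=> H) (@weakly_measurable _ Omega R H).
Proof.
move=> sH; split.
- split; first exact: weakly_measurable_cst.
  by move=> a u v; exact: weakly_measurable_linear.
- by move=> u; exact: measurable_rnorm.
- by move=> v vm y; apply: vm; exact: weakly_measurable_cst.
- have [z zP] := separable_dense_seq sH; exists (fun n _ => z n); split.
    by move=> n; exact: weakly_measurable_cst.
  move=> _; apply/dense_rnormP => x r r0; have [n xn] := zP x r r0.
  exists (z n) => //; exists n.+1, (fun i => (i == ord_max)%:R).
  rewrite big_ord_recr /= eqxx scale1r big1 ?add0r// => i _.
  by rewrite eqE /= ltn_eqF ?scale0r.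
Qed.

(** The sesquilinear forms follow from the quadratic ones by polarization. *)
Lemma cintegral_polarization (mu : {measure set Omega -> \bar R})
    (T : H -> Omega -> H) E x y : separable_space H -> is_povm M ->
  (forall (a : R[i]) x y t, T (a *: x + y) t = a *: T x t + T y t) ->
  (forall x, weakly_measurable (T x)) ->
  (forall x E, measurable E ->
     (\int[mu]_(t in E) (rnorm (T x t) ^+ 2)%:E =
       (Re (inner (M E x) x))%:E)%E) ->
  measurable E ->
  inner (M E x) y = cintegral mu E (fun t => inner (T x t) (T y t)).
Proof.
move=> sH povmM linT Tm TM mE.
have TD u w t : T (u + w) t = T u t + T w t.
  by have := linT 1 u w t; rewrite !scale1r.
have TZ a u t : T (a *: u) t = a *: T u t.
  have T0 : T 0 t = 0.
    by have /eqP := TD 0 0 t; rewrite addr0 -subr_eq subrr eq_sym => /eqP.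
  by have := linT a u 0 t; rewrite T0 !addr0.
have TB u w t : T (u - w) t = T u t - T w t.
  by rewrite -scaleN1r TD TZ scaleN1r.
have Ti z : mu.-integrable E (EFin \o (fun t => rnorm (T z t) ^+ 2)).
  apply/integrableP; split.
    apply/measurable_EFinP; apply: measurable_funTS.
    exact: measurable_sqr_rnorm.
  under eq_integral do rewrite /= ger0_norm ?sqr_ge0//.
  by rewrite TM// ltry.
have RT z : Rintegral mu E (fun t => rnorm (T z t) ^+ 2) =
    Re (inner (M E z) z).
  by rewrite /Rintegral TM.
have Rint u w : Rintegral mu E
      (fun t => (rnorm (T u t) ^+ 2 - rnorm (T w t) ^+ 2) / 4) =
    (Re (inner (M E u) u) - Re (inner (M E w) w)) / 4.
  rewrite RintegralZr//; last exact: (integrableB mE (Ti u) (Ti w)).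
  by rewrite RintegralB// !RT.
have im0 z : Im (inner (M E z) z) = 0 by apply: ger0_Im; exact: povm_ge0.
rewrite /cintegral.
under [fun t => Re _]eq_fun do rewrite Re_inner_polar -TD -TB.
under [fun t => Im _]eq_fun do rewrite Im_inner_polar -TZ -TD -TB.
rewrite !Rint povm_polarization.
by apply: complexP; rewrite /= !(ReM, ImM, ReD, ImD, ReN, ImN) /= !im0; field.
Qed.

Lemma framed_povm_ovf (D : set H) : separable_space H -> is_framed_povm M ->
  dense_subspace D -> exists F : OVF Omega D, gives_rise_to F M.
Proof.
move=> sH [povmM invM] dD; have [M0 _ _] := povmM.
have [bM pM] := M0 setT measurableT.
have [mu [T [linT Tm TM]]] := povm_dilation sH povmM.
have [A A0 AM] := form_coercive pM bM invM.
have [B B1 BM] := form_bounded bM.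
unshelve eexists.
  apply: (@Build_OVF _ Omega R H D mu (fun=> H) (@weakly_measurable _ Omega R H)
    (fun t x => T x t)) => //.
  - exact: weakly_measurable_family.
  - by move=> x _; split; [exact: Tm|rewrite TM// ltry].
  - exists A, B; split => //; first by lra.
    move=> x _; under eq_integral do rewrite -rnorm_sqr.
    by rewrite TM// !lee_fin AM BM.
move=> x y E _ _ mE; exact: (cintegral_polarization _ _ sH povmM linT Tm TM mE).
Qed.

End existence.

Section uniqueness.
Context d (Omega : measurableType d) (R : realType) (H : hilbertType R).
Context (M : set Omega -> {linear H -> H}) (D : set H).
Implicit Types F : OVF Omega D.

Lemma ovf_map_linear F t (a : R[i]) x y : D x -> D y ->
  ovf_map F t (a *: x + y) = a *: ovf_map F t x + ovf_map F t y.
Proof. by case: F => mu K S T ? ? linT ? ?; exact: linT. Qed.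

Lemma ovf_measurable F x : D x ->
  measurable_fun setT (fun t => rnorm (ovf_map F t x) ^+ 2).
Proof.
case: F => mu K S T ? [_ Sm _ _] ? TS ? /= /TS[Tx _].
by apply: measurable_funX; exact: Sm.
Qed.

Lemma ovf_quad F x E : gives_rise_to F M -> D x -> measurable E ->
  (\int[ovf_measure F]_(t in E) (rnorm (ovf_map F t x) ^+ 2)%:E =
    (Re (inner (M E x) x))%:E)%E.
Proof.
move=> FM Dx mE; rewrite (FM x x E Dx Dx mE) /cintegral /= /Rintegral /ovf_form.
under [in RHS]eq_integral do rewrite -rnorm_sqr.
rewrite fineK// ge0_fin_numE; last first.
  by apply: integral_ge0 => t _; rewrite lee_fin sqr_ge0.
have fin : (\int[ovf_measure F]_t (rnorm (ovf_map F t x) ^+ 2)%:E < +oo)%E.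
  by case: F {FM} => mu K S T ? ? ? TS ? /=; have [] := TS x Dx.
apply: le_lt_trans fin; apply: ge0_subset_integral => //.
  by apply/measurable_EFinP; exact: ovf_measurable.
by move=> t _; rewrite lee_fin sqr_ge0.
Qed.

(** Restriction to E is multiplication of the integrand by the indicator of
    E. *)
Lemma ovf_quad_density F (mu : {measure set Omega -> \bar R}) g x E :
  gives_rise_to F M -> is_RN_derivative (ovf_measure F) mu g -> D x ->
  measurable E ->
  (\int[mu]_(t in E) ((rnorm (ovf_map F t x) ^+ 2)%:E * (g t)%:E) =
    (Re (inner (M E x) x))%:E)%E.
Proof.
move=> FM Fg Dx mE; rewrite -(ovf_quad FM Dx mE).
rewrite integral_mkcond [RHS]integral_mkcond.
pose q t := \1_E t * rnorm (ovf_map F t x) ^+ 2.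
have qE t : ((fun t => (rnorm (ovf_map F t x) ^+ 2)%:E) \_ E) t = (q t)%:E.
  rewrite patchE /q indicE; case: ifPn => tE; last by rewrite mul0r.
  by rewrite mul1r.
under [RHS]eq_integral do rewrite qE.
rewrite (density_integral Fg).
- apply: eq_integral => t _; rewrite patchE /q indicE.
  by case: ifPn => tE; rewrite ?mul1r// mul0r mul0e.
- apply: measurable_funM; first exact: measurable_indic.
  exact: ovf_measurable.
- by move=> t; rewrite mulr_ge0 ?sqr_ge0.
Qed.

(** Both functions are nonnegative, integrable, and have over every measurable E
    the integral Re <M(E) x, x>. *)
Lemma ovf_quad_unique F1 F2 (mu : {measure set Omega -> \bar R}) g1 g2 x :
  gives_rise_to F1 M -> gives_rise_to F2 M ->
  is_RN_derivative (ovf_measure F1) mu g1 ->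
  is_RN_derivative (ovf_measure F2) mu g2 -> D x ->
  {ae mu, forall t, rnorm (ovf_map F1 t x) ^+ 2 * g1 t =
                    rnorm (ovf_map F2 t x) ^+ 2 * g2 t}.
Proof.
move=> F1M F2M F1g F2g Dx.
have mq F g : is_RN_derivative (ovf_measure F) mu g ->
    measurable_fun setT
      (fun t => (rnorm (ovf_map F t x) ^+ 2)%:E * (g t)%:E)%E.
  move=> [gm _ _]; apply: emeasurable_funM; apply/measurable_EFinP => //.
  exact: ovf_measurable.
have : ae_eq mu setT
    (fun t => (rnorm (ovf_map F1 t x) ^+ 2)%:E * (g1 t)%:E)%E
    (fun t => (rnorm (ovf_map F2 t x) ^+ 2)%:E * (g2 t)%:E)%E.
  apply: integral_ae_eq => //; last 2 first.
  - exact: mq.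
  - by move=> E _ mE; rewrite (ovf_quad_density F1M)// (ovf_quad_density F2M).
  apply/integrableP; split; first exact: mq.
  under eq_integral => t _.
    rewrite gee0_abs; last first.
      by have [_ g0 _] := F1g; rewrite mule_ge0// lee_fin ?sqr_ge0.
    over.
  by rewrite (ovf_quad_density F1M)// ltry.
by apply: filterS => t /(_ Logic.I) -[].
Qed.

(** Polarization at each point, from the identities for x + a y with a in
    {1, -1, i, -i}. *)
Lemma ovf_form_unique F1 F2 (mu : {measure set Omega -> \bar R}) g1 g2 x y :
  dense_subspace D -> gives_rise_to F1 M -> gives_rise_to F2 M ->
  is_RN_derivative (ovf_measure F1) mu g1 ->
  is_RN_derivative (ovf_measure F2) mu g2 -> D x -> D y ->
  {ae mu, forall t, ovf_form F1 t x y * (g1 t)%:C =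
                    ovf_form F2 t x y * (g2 t)%:C}.
Proof.
move=> [_ Dlin _] F1M F2M F1g F2g Dx Dy.
have ae (a : R[i]) : {ae mu, forall t,
    rnorm (a *: ovf_map F1 t y + ovf_map F1 t x) ^+ 2 * g1 t =
    rnorm (a *: ovf_map F2 t y + ovf_map F2 t x) ^+ 2 * g2 t}.
  have := ovf_quad_unique F1M F2M F1g F2g (Dlin a y x Dy Dx).
  by apply: filterS => t; rewrite !ovf_map_linear.
have aeN (a : R[i]) : {ae mu, forall t,
    rnorm (ovf_map F1 t x - a *: ovf_map F1 t y) ^+ 2 * g1 t =
    rnorm (ovf_map F2 t x - a *: ovf_map F2 t y) ^+ 2 * g2 t}.
  by apply: filterS (ae (- a)) => t; rewrite !scaleNr ![- _ + _]addrC.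
have aeP (a : R[i]) : {ae mu, forall t,
    rnorm (ovf_map F1 t x + a *: ovf_map F1 t y) ^+ 2 * g1 t =
    rnorm (ovf_map F2 t x + a *: ovf_map F2 t y) ^+ 2 * g2 t}.
  by apply: filterS (ae a) => t; rewrite ![_ + ovf_map _ _ x]addrC.
have re : {ae mu, forall t, Re (ovf_form F1 t x y) * g1 t =
                            Re (ovf_form F2 t x y) * g2 t}.
  apply: filterS2 (aeP 1) (aeN 1) => t; rewrite !scale1r /ovf_form.
  by rewrite !Re_inner_polar; lra.
have im : {ae mu, forall t, Im (ovf_form F1 t x y) * g1 t =
                            Im (ovf_form F2 t x y) * g2 t}.
  apply: filterS2 (aeP 'i%C) (aeN 'i%C) => t; rewrite /ovf_form.
  by rewrite !Im_inner_polar; lra.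
apply: filterS2 re im => t ret imt; apply: complexP.
  by rewrite !ReM /= !mulr0 !subr0.
by rewrite !ImM /= !mulr0 !add0r.
Qed.

End uniqueness.

Theorem mainTheorem3 (R : realType) (H : hilbertType R)
    (d : measure_display) (Omega : measurableType d)
    (M : set Omega -> {linear H -> H}) (D : set H) :
  separable_space H ->
  is_framed_povm M ->
  dense_subspace D ->
  (forall x, D x ->
     sigma_finite setT (vmeasure_total_variation (fun E => M E x))) ->
  (exists F : OVF Omega D, gives_rise_to F M) /\
  (forall F1 F2 : OVF Omega D, gives_rise_to F1 M -> gives_rise_to F2 M ->
   forall g1 g2 : Omega -> R,
     let mu := measure_add (ovf_measure F1) (ovf_measure F2) in
     is_RN_derivative (ovf_measure F1) mu g1 ->
     is_RN_derivative (ovf_measure F2) mu g2 ->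
     forall x y, D x -> D y ->
       {ae mu, forall t, ovf_form F1 t x y * (g1 t)%:C =
                         ovf_form F2 t x y * (g2 t)%:C}).
Proof.
move=> sH framedM dD _; split; first exact: framed_povm_ovf.
move=> F1 F2 F1M F2M g1 g2 mu F1g F2g x y.
exact: (ovf_form_unique dD F1M F2M F1g F2g).
Qed.
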